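(* Any three-dimensional solvable subalgebra of $\mathfrak{sp}(4,\mathbb{C})$ containing no nonzero semisimple elements but which does not consist entirely of nilpotent elements must be equivalent to one of the following inequivalent subalgebras: $$\langle T_{1,1}+X_{\beta},X_{\alpha+\beta},X_{\alpha+2\beta}\rangle\sim\langle T_{1,-1}+X_{\alpha+\beta},X_{\beta},X_{\alpha+2\beta}\rangle,$$ $$\langle T_{1,-1}+X_{\alpha+\beta},X_{\alpha},X_{\alpha+2\beta}\rangle,$$ $$\langle T_{1,0}+X_{\alpha},X_{\alpha+\beta},X_{\alpha+2\beta}\rangle\sim\langle T_{0,1}+X_{\alpha+2\beta},X_{\alpha},X_{\alpha+\beta}\rangle .$$ (Algebras on the same line are equivalent; algebras on different lines are inequivalent.)
   Context: Let $J=\begin{pmatrix}0&0&1&0\\0&0&0&1\\-1&0&0&0\\0&-1&0&0\end{pmatrix}$. $\mathfrak{sp}(4,\mathbb{C})$ is the Lie algebra of $4\times4$ complex matrices $X$ with $JX^tJ=X$, and $Sp(4,\mathbb{C})=\{g\in GL(4,\mathbb{C}) : gJg^t=J\}$, acting on $\mathfrak{sp}(4,\mathbb{C})$ by conjugation $X\mapsto gXg^{-1}$. Elements are semisimple (nilpotent) if they are so as matrices. For $a,b\in\mathbb{C}$, $T_{a,b}=\mathrm{diag}(a,b,-a,-b)$. With $E_{ij}$ the matrix units, $X_\alpha=E_{24}$, $X_\beta=E_{12}-E_{43}$, $X_{\alpha+\beta}=E_{14}+E_{23}$, $X_{\alpha+2\beta}=E_{13}$. $\langle\,\cdot\,\rangle$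 denotes the complex linear span. Two subalgebras are equivalent, written $\sim$, if some $g\in Sp(4,\mathbb{C})$ conjugates one onto the other. *)

(* Defs.v *)
From HB Require Import structures.
From mathcomp Require Import all_boot all_order all_algebra.
From mathcomp Require Export reals complex.

Set Implicit Arguments.
Unset Strict Implicit.
Unset Printing Implicit Defensive.

Import GRing.Theory.
Local Open Scope ring_scope.

Section MatrixLieAlgebras.
Variables (F : fieldType) (n : nat).
Implicit Types (U V W L : {vspace 'M[F]_n}) (X Y : 'M[F]_n).

Definition lie_bracket X Y : 'M[F]_n := X *m Y - Y *m X.

(* [U, V]: as for the product of subspaces in falgebra, brackets of basis
   vectors suffice; see mem_lie_bracketv and lie_bracketvP. *)
Definition lie_bracketv U V : {vspace 'M[F]_n} :=
  <<[seq lie_bracket X Y | X <- vbasis U, Y <- vbasis V]>>%VS.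

Lemma mem_lie_bracketv U V :
  {in U & V, forall X Y, lie_bracket X Y \in lie_bracketv U V}.
Proof.
move=> X Y /coord_vbasis-> /coord_vbasis->; rewrite /lie_bracket.
rewrite mulmx_suml mulmx_sumr -sumrB.
under eq_bigr do rewrite mulmx_sumr mulmx_suml -sumrB.
apply: memv_suml => i _; apply: memv_suml => j _.
rewrite -!scalemxAl -!scalemxAr !scalerA.
rewrite [X in _ - X *: _]mulrC -scalerBr memvZ // memv_span //.
by apply/allpairsP; exists ((vbasis U)`_i, (vbasis V)`_j); rewrite !memt_nth.
Qed.

Lemma lie_bracketvP U V W :
  reflect {in U & V, forall X Y, lie_bracket X Y \in W}
          (lie_bracketv U V <= W)%VS.
Proof.
apply: (iffP idP) => [sW X Y UX VY | sW].
  by rewrite (subvP sW) ?mem_lie_bracketv.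
apply/span_subvP=> _ /allpairsP[[X Y] /= [UX VY ->]].
by rewrite sW ?vbasis_mem.
Qed.

Definition derived_algebra (k : nat) L : {vspace 'M[F]_n} :=
  iter k (fun U => lie_bracketv U U) L.

Definition lie_solvable L : Prop := exists k, derived_algebra k L = 0%VS.

End MatrixLieAlgebras.

Section Sp4.
Variable F : fieldType.
Implicit Types (X g : 'M[F]_4) (L : {vspace 'M[F]_4}).

Definition J : 'M[F]_4 :=
  block_mx (0 : 'M_2) (1%:M : 'M_2) (- 1%:M : 'M_2) (0 : 'M_2).

Definition sp4 : {pred 'M[F]_4} := [pred X | J *m X^T *m J == X].

Definition Sp4 : {pred 'M[F]_4} :=
  [pred g | (g \in unitmx) && (g *m J *m g^T == J)].

Definition sp4_subalgebra L : Prop :=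
  (forall X, X \in L -> X \in sp4) /\
  (forall X Y, X \in L -> Y \in L -> lie_bracket X Y \in L).

(* "diagonalizable" is semisimplicity when F is algebraically closed, as it is
   for the complex numbers. *)
Definition semisimple_mx X : Prop := diagonalizable X.

Definition nilpotent_mx X : Prop := exists k : nat, X ^+ k = 0.

Definition sp4_equiv (L L' : {vspace 'M[F]_4}) : Prop :=
  exists2 g, g \in Sp4 &
    forall Y, Y \in L' <-> exists2 X, X \in L & Y = g *m X *m invmx g.

(* Matrix units with indices counted from 1. *)
Definition E (i j : nat) : 'M[F]_4 := delta_mx (inord i.-1) (inord j.-1).

Definition T (a b : F) : 'M[F]_4 :=
  diag_mx (\row_(i < 4) [:: a; b; - a; - b]`_i).

(* Root vectors; a is the long simple root, b the short one: X_a2b stands for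
   X_(a + 2b). *)
Definition X_a : 'M[F]_4 := E 2 4.
Definition X_b : 'M[F]_4 := E 1 2 - E 4 3.
Definition X_ab : 'M[F]_4 := E 1 4 + E 2 3.
Definition X_a2b : 'M[F]_4 := E 1 3.

Definition L1 : {vspace 'M[F]_4} := <<[:: T 1 1 + X_b; X_ab; X_a2b]%R>>%VS.
Definition L1' : {vspace 'M[F]_4} := <<[:: T 1 (-1) + X_ab; X_b; X_a2b]%R>>%VS.
Definition L2 : {vspace 'M[F]_4} := <<[:: T 1 (-1) + X_ab; X_a; X_a2b]%R>>%VS.
Definition L3 : {vspace 'M[F]_4} := <<[:: T 1 0 + X_a; X_ab; X_a2b]%R>>%VS.
Definition L3' : {vspace 'M[F]_4} := <<[:: T 0 1 + X_a2b; X_a; X_ab]%R>>%VS.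

End Sp4.

Arguments L1 {F}.
Arguments L1' {F}.
Arguments L2 {F}.
Arguments L3 {F}.
Arguments L3' {F}.

(* Main.v *)
Require Import Defs.
From HB Require Import structures.
From mathcomp Require Import all_boot all_order all_algebra.
From mathcomp Require Import reals complex.
From mathcomp Require Import boolp ring.

Set Implicit Arguments.
Unset Strict Implicit.
Unset Printing Implicit Defensive.

Import Order.TTheory GRing.Theory Num.Theory.
Local Open Scope ring_scope.

(* Choose X in L that is not nilpotent; by hypothesis no nonzero multiple of X
   is semisimple. By Cayley-Hamilton and the symplectic adjunction X* = - X, an
   even polynomial (x^2 - s)(x^2 - t) annihilates X. If s and t were distinct
   and nonzero then X would be diagonalizable, so after rescaling X is
   symplectically conjugate to T_{1,1} + X_b or to T_{1,0} + X_a; a symplectic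
   basis adapted to X is built from vectors of the form w p(X) and from dual
   vectors under the form. Then L is stable under ad X, hence graded by the
   generalized eigenspaces of ad X. As the semisimple part of X is not in L, the
   degree 0 part of L is the line of X, and closure under the nilpotent part of
   ad X and under brackets leaves only few possibilities for the remaining two
   dimensions. Solvability of L is then automatic. The listed algebras are
   separated by the pairs of eigenvalues that an inner derivation can have. *)

(** The four cases are closed [Ordinal] terms, at which list lookups and matrix entries reduce by
    computation. *)
Lemma ord4_ind (P : 'I_4 -> Prop) :
  P (@Ordinal 4 0 isT) -> P (@Ordinal 4 1 isT) ->
  P (@Ordinal 4 2 isT) -> P (@Ordinal 4 3 isT) -> forall i, P i.
Proof.
move=> P0 P1 P2 P3 -[[|[|[|[|//]]]] lti]; rewrite (bool_irrelevance lti isT);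
  by [].
Qed.

(** * Coordinates on sp(4) *)

Section Coordinates.
Variable F : fieldType.

(** Nested lists make the operations on explicit matrices computable, so that matrix identities
    become [ring] goals on entries. *)
Definition mx4 (s : seq (seq F)) : 'M[F]_4 := \matrix_(i, j) (nth [::] s i)`_j.

Lemma sum_ord4 (V : nmodType) (f : 'I_4 -> V) :
  \sum_i f i = f (@Ordinal 4 0 isT) + f (@Ordinal 4 1 isT)
             + f (@Ordinal 4 2 isT) + f (@Ordinal 4 3 isT).
Proof.
rewrite !big_ord_recr big_ord0 /= add0r.
by do 3?[congr (_ + _)]; congr (f _); apply: val_inj.
Qed.

Lemma mx4_eta (X : 'M[F]_4) :
  X = mx4 (mkseq (fun i => mkseq (fun j => X (inord i) (inord j)) 4) 4).
Proof.
by apply/matrixP=> i j; rewrite mxE !nth_mkseq // !inord_val.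
Qed.

Lemma mx4M s t : mx4 s *m mx4 t = mx4 (mkseq (fun i => mkseq (fun j =>
  (nth [::] s i)`_0 * (nth [::] t 0)`_j + (nth [::] s i)`_1 * (nth [::] t 1)`_j
  + (nth [::] s i)`_2 * (nth [::] t 2)`_j
  + (nth [::] s i)`_3 * (nth [::] t 3)`_j) 4) 4).
Proof.
by apply/matrixP=> i j; rewrite !mxE sum_ord4 !mxE !nth_mkseq.
Qed.

Lemma mx4D s t : mx4 s + mx4 t = mx4 (mkseq (fun i => mkseq (fun j =>
  (nth [::] s i)`_j + (nth [::] t i)`_j) 4) 4).
Proof. by apply/matrixP=> i j; rewrite !mxE !nth_mkseq. Qed.

Lemma mx4N s : - mx4 s = mx4 (mkseq (fun i => mkseq (fun j =>
  - (nth [::] s i)`_j) 4) 4).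
Proof. by apply/matrixP=> i j; rewrite !mxE !nth_mkseq. Qed.

Lemma mx4Z c s : c *: mx4 s = mx4 (mkseq (fun i => mkseq (fun j =>
  c * (nth [::] s i)`_j) 4) 4).
Proof. by apply/matrixP=> i j; rewrite !mxE !nth_mkseq. Qed.

Lemma mx4T s : (mx4 s)^T = mx4 (mkseq (fun i => mkseq (fun j =>
  (nth [::] s j)`_i) 4) 4).
Proof. by apply/matrixP=> i j; rewrite !mxE !nth_mkseq. Qed.

Lemma mx4_inj s t : mx4 s = mx4 t ->
  forall i j, (i < 4)%N -> (j < 4)%N -> (nth [::] s i)`_j = (nth [::] t i)`_j.
Proof.
move=> /matrixP eqst i j lti ltj.
by have := eqst (Ordinal lti) (Ordinal ltj); rewrite !mxE.
Qed.

(** The block matrix with rows $(A, B)$ and $(C, -A^t)$, where $B$ and $C$ are symmetric. The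
    arguments are the ten coordinates of sp(4). *)
Definition sp_mx (a11 a12 a21 a22 b11 b12 b22 c11 c12 c22 : F) : 'M[F]_4 :=
  mx4 [:: [:: a11; a12; b11; b12];
          [:: a21; a22; b12; b22];
          [:: c11; c12; - a11; - a21];
          [:: c12; c22; - a12; - a22]].

Lemma J_mx4 : J F = mx4 [:: [:: 0; 0; 1; 0]; [:: 0; 0; 0; 1];
                         [:: -1; 0; 0; 0]; [:: 0; -1; 0; 0]].
Proof.
apply/matrixP=> i j; rewrite /J /block_mx !mxE.
case: (@splitP 2 2 i) => -[[|[|//]] ?] /= ei; rewrite !mxE;
  case: (@splitP 2 2 j) => -[[|[|//]] ?] /= ej;
  by rewrite !mxE ?ei ?ej /= ?oppr0.
Qed.

End Coordinates.

Ltac mx4_compute :=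
  rewrite ?J_mx4 ?/sp_mx;
  repeat (first [rewrite mx4T | rewrite mx4M | rewrite mx4N | rewrite mx4Z
    | rewrite mx4D] => /=);
  congr (mx4 _); repeat apply: (f_equal2 cons); rewrite //=.

Section Sp.
Variable F : fieldType.

Lemma sp_mx_sp4  a11 a12 a21 a22 b11 b12 b22 c11 c12 c22 :
  (sp_mx a11 a12 a21 a22 b11 b12 b22 c11 c12 c22) \in (@sp4 F).
Proof. apply/eqP; mx4_compute; ring. Qed.

(** Ten entries of [X] serve as coordinates; the other six are read off from the matching entries of
    $JX^tJ = X$. *)
Lemma sp4_sp_mx (X : 'M[F]_4) : X \in @sp4 F ->
  exists a11 a12 a21 a22 b11 b12 b22 c11 c12 c22,
    X = sp_mx a11 a12 a21 a22 b11 b12 b22 c11 c12 c22.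
Proof.
rewrite (mx4_eta X) /=; set x := fun i j : nat => X (inord i) (inord j).
move=> /eqP; rewrite J_mx4 mx4T /= mx4M /= mx4M /= => /mx4_inj XE.
exists (x 0 0)%N, (x 0 1)%N, (x 1 0)%N, (x 1 1)%N, (x 0 2)%N, (x 0 3)%N,
  (x 1 3)%N, (x 2 0)%N, (x 2 1)%N, (x 3 1)%N.
mx4_compute.
- by apply: etrans (esym (XE 1%N 2%N isT isT)) _; rewrite /x /=; ring.
- by apply: etrans (esym (XE 2%N 2%N isT isT)) _; rewrite /x /=; ring.
- by apply: etrans (esym (XE 2%N 3%N isT isT)) _; rewrite /x /=; ring.
- by apply: etrans (esym (XE 3%N 0%N isT isT)) _; rewrite /x /=; ring.
- by apply: etrans (esym (XE 3%N 2%N isT isT)) _; rewrite /x /=; ring.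
- by apply: etrans (esym (XE 3%N 3%N isT isT)) _; rewrite /x /=; ring.
Qed.

Lemma sp_mx0 : sp_mx 0 0 0 0 0 0 0 0 0 0 = 0 :> 'M[F]_4.
Proof. by rewrite [RHS](mx4_eta 0); mx4_compute; rewrite mxE ?oppr0. Qed.

Lemma sp_mxD a11 a12 a21 a22 b11 b12 b22 c11 c12 c22
    x11 x12 x21 x22 y11 y12 y22 z11 z12 z22 :
  sp_mx a11 a12 a21 a22 b11 b12 b22 c11 c12 c22 +
    sp_mx x11 x12 x21 x22 y11 y12 y22 z11 z12 z22 =
  sp_mx (a11 + x11) (a12 + x12) (a21 + x21) (a22 + x22)
    (b11 + y11) (b12 + y12) (b22 + y22)
    (c11 + z11) (c12 + z12) (c22 + z22) :> 'M[F]_4.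
Proof. by mx4_compute; ring. Qed.

Lemma sp_mxZ t a11 a12 a21 a22 b11 b12 b22 c11 c12 c22 :
  t *: sp_mx a11 a12 a21 a22 b11 b12 b22 c11 c12 c22 =
  sp_mx (t * a11) (t * a12) (t * a21) (t * a22)
    (t * b11) (t * b12) (t * b22) (t * c11) (t * c12) (t * c22) :> 'M[F]_4.
Proof. by mx4_compute; ring. Qed.

Lemma sp_mxN a11 a12 a21 a22 b11 b12 b22 c11 c12 c22 :
  - sp_mx a11 a12 a21 a22 b11 b12 b22 c11 c12 c22 =
  sp_mx (- a11) (- a12) (- a21) (- a22)
    (- b11) (- b12) (- b22) (- c11) (- c12) (- c22) :> 'M[F]_4.
Proof. by mx4_compute; ring. Qed.

Lemma sp_bracket a11 a12 a21 a22 b11 b12 b22 c11 c12 c22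
    x11 x12 x21 x22 y11 y12 y22 z11 z12 z22 :
  lie_bracket (sp_mx a11 a12 a21 a22 b11 b12 b22 c11 c12 c22)
    (sp_mx x11 x12 x21 x22 y11 y12 y22 z11 z12 z22 : 'M[F]_4) =
  sp_mx
    (a12 * x21 - x12 * a21 + (b11 * z11 + b12 * z12) - (y11 * c11 + y12 * c12))
    (a11 * x12 + a12 * x22 - (x11 * a12 + x12 * a22)
      + (b11 * z12 + b12 * z22) - (y11 * c12 + y12 * c22))
    (a21 * x11 + a22 * x21 - (x21 * a11 + x22 * a21)
      + (b12 * z11 + b22 * z12) - (y12 * c11 + y22 * c12))
    (a21 * x12 - x21 * a12 + (b12 * z12 + b22 * z22) - (y12 * c12 + y22 * c22))
    (2 * (a11 * y11 + a12 * y12) - 2 * (x11 * b11 + x12 * b12))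
    (a11 * y12 + a12 * y22 + a21 * y11 + a22 * y12
      - (x11 * b12 + x12 * b22 + x21 * b11 + x22 * b12))
    (2 * (a21 * y12 + a22 * y22) - 2 * (x21 * b12 + x22 * b22))
    (2 * (c11 * x11 + c12 * x21) - 2 * (z11 * a11 + z12 * a21))
    (c11 * x12 + c12 * x22 + c12 * x11 + c22 * x21
      - (z11 * a12 + z12 * a22 + z12 * a11 + z22 * a21))
    (2 * (c12 * x12 + c22 * x22) - 2 * (z12 * a12 + z22 * a22)).
Proof. by rewrite /lie_bracket; mx4_compute; ring. Qed.

Lemma sp_mx_inj a11 a12 a21 a22 b11 b12 b22 c11 c12 c22
    x11 x12 x21 x22 y11 y12 y22 z11 z12 z22 :
  sp_mx a11 a12 a21 a22 b11 b12 b22 c11 c12 c22 =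
    sp_mx x11 x12 x21 x22 y11 y12 y22 z11 z12 z22 :> 'M[F]_4 ->
  [/\ [/\ a11 = x11, a12 = x12, a21 = x21 & a22 = x22],
      [/\ b11 = y11, b12 = y12 & b22 = y22] &
      [/\ c11 = z11, c12 = z12 & c22 = z22]].
Proof.
move=> /mx4_inj e; split; split.
- exact: (e 0 0)%N.
- exact: (e 0 1)%N.
- exact: (e 1 0)%N.
- exact: (e 1 1)%N.
- exact: (e 0 2)%N.
- exact: (e 0 3)%N.
- exact: (e 1 3)%N.
- exact: (e 2 0)%N.
- exact: (e 2 1)%N.
- exact: (e 3 1)%N.
Qed.

Lemma T_sp (a b : F) : T a b = sp_mx a 0 0 b 0 0 0 0 0 0.
Proof.
apply/matrixP; elim/ord4_ind; elim/ord4_ind; rewrite !mxE /= ?oppr0 //.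
Qed.

Let E_mx4 i j : (i.-1 < 4)%N -> (j.-1 < 4)%N ->
  E F i j = mx4 (mkseq (fun i' => mkseq (fun j' =>
    ((i' == i.-1) && (j' == j.-1))%:R) 4) 4).
Proof.
move=> ? ?; apply/matrixP=> i' j'.
by rewrite !mxE !nth_mkseq // -!val_eqE /= !inordK.
Qed.

Lemma X_a_sp : X_a F = sp_mx 0 0 0 0 0 0 1 0 0 0.
Proof. by rewrite /X_a !E_mx4 //= /sp_mx oppr0. Qed.

Lemma X_b_sp : X_b F = sp_mx 0 1 0 0 0 0 0 0 0 0.
Proof. by rewrite /X_b !E_mx4 //=; mx4_compute; ring. Qed.

Lemma X_ab_sp : X_ab F = sp_mx 0 0 0 0 0 1 0 0 0 0.
Proof. by rewrite /X_ab !E_mx4 //=; mx4_compute; ring. Qed.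

Lemma X_a2b_sp : X_a2b F = sp_mx 0 0 0 0 1 0 0 0 0 0.
Proof. by rewrite /X_a2b !E_mx4 //= /sp_mx oppr0. Qed.

End Sp.

(** * Spans and stable subspaces *)

Section Span.
Variables (F : fieldType) (vT : vectType F).
Implicit Types (s : seq vT) (L : {vspace vT}).

Lemma span3P (x y z v : vT) :
  reflect (exists a b c, v = a *: x + b *: y + c *: z)
          (v \in <<[:: x; y; z]>>%VS).
Proof.
apply: (iffP idP) => [|[a [b [c ->]]]].
  rewrite !span_cons span_nil addv0.
  case/memv_addP=> _ /vlineP[a ->] [v' v'yz ->].
  case/memv_addP: v'yz => _ /vlineP[b ->] [w /vlineP[c ->] ->].
  by exists a, b, c; rewrite addrA.
by rewrite !memvD ?memvZ ?memv_span // !inE eqxx ?orbT.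
Qed.

Lemma free_subset_leq s L : free s -> {subset s <= L} -> (size s <= \dim L)%N.
Proof. by move=> /eqP <- sL; apply/dimvS/span_subvP. Qed.

Lemma free_subset_eq s L :
  free s -> {subset s <= L} -> size s = \dim L -> L = <<s>>%VS.
Proof.
move=> frs sL dimL; apply/esym/eqP; rewrite eqEdim -dimL (eqP frs) leqnn andbT.
exact/span_subvP.
Qed.

(** The span of [s] has dimension at most [size s], so it cannot be strictly larger than [L]. *)
Lemma subset_span_eq s L :
  {subset L <= <<s>>%VS} -> (size s <= \dim L)%N -> L = <<s>>%VS.
Proof.
move=> sL dimL; apply/eqP; rewrite eqEdim (leq_trans (dim_span s)) ?andbT //.
exact/subvP.
Qed.

(** Coefficients indexed by [nat] let the sum over a concrete list unfold term by term. *)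
Lemma free_coefs s :
  (forall k : nat -> F, \sum_(i < size s) k i *: s`_i = 0 ->
     forall i, (i < size s)%N -> k i = 0) ->
  free s.
Proof.
move=> k0; suff: free (in_tuple s) by [].
apply/freeP => k sum0 i.
(* A family indexed by ordinals is extended by 0 beyond the end of the list. *)
have := k0 (fun j => if insub j is Some j' then k j' else 0) _ i (ltn_ord i).
rewrite valK; apply; rewrite -[RHS]sum0; apply: eq_bigr => j _.
by rewrite valK.
Qed.

End Span.

Section LieBracket.
Variables (F : fieldType) (n : nat).

(** Makes ad [X] a linear map, to which [stable_component] can be applied. *)
Fact lie_bracket_is_linear (X : 'M[F]_n) : linear (lie_bracket X).
Proof.
move=> c Y Z; rewrite /lie_bracket mulmxDr mulmxDl -scalemxAr -scalemxAl.
by rewrite scalerBr opprD addrACA.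
Qed.

HB.instance Definition _ (X : 'M[F]_n) :=
  GRing.isLinear.Build F _ _ _ (lie_bracket X) (lie_bracket_is_linear X).

End LieBracket.

(** * Generalized eigenspace components in a stable subspace *)

Section StableComponent.
Variables (F : fieldType) (vT : vectType F) (D : {linear vT -> vT}).
Implicit Types (rs ss : seq F) (u v : vT) (L : {vspace vT}).

(** The product of the operators $D - r$ for [r] in [rs], applied to [u]. When it vanishes, [u] lies
    in the sum of the generalized eigenspaces of [D] for the scalars in [rs]. *)
Definition shifts rs u := foldl (fun w r => D w - r *: w) u rs.

(** Polynomials in [D] commute with each other. *)
Lemma shifts_comm rs u s :
  shifts rs (D u - s *: u) = D (shifts rs u) - s *: shifts rs u.
Proof.
elim: rs u => //= r rs IHrs u; rewrite -IHrs; congr shifts.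
rewrite 2!(linearB D) 2!(linearZ_LR D) /= !scalerBr !scalerA [s * r]mulrC.
by rewrite !opprB [LHS]addrACA [RHS]addrACA; congr (_ + _); rewrite addrC.
Qed.

Lemma shiftsD rs u v : shifts rs (u + v) = shifts rs u + shifts rs v.
Proof.
elim: rs u v => //= r rs IHrs u v; rewrite -IHrs; congr shifts.
by rewrite linearD scalerDr opprD addrACA.
Qed.

Lemma shifts0 rs : shifts rs 0 = 0.
Proof. by elim: rs => //= r rs IHrs; rewrite linear0 scaler0 subr0. Qed.

(** Allows all generalized eigenspaces but one to be gathered into a single complement. *)
Lemma shifts_cat_eq0 rs ss u v :
  shifts rs u = 0 -> shifts ss v = 0 -> shifts (rs ++ ss) (u + v) = 0.
Proof.
move=> ku kv; rewrite shiftsD /shifts !foldl_cat.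
rewrite -/(shifts rs u) -/(shifts rs v) -!/(shifts ss _) ku shifts0 add0r.
elim: rs v kv {ku} => //= r rs IHrs v kv; apply: IHrs.
by rewrite shifts_comm kv linear0 scaler0 subr0.
Qed.

(* Two different shifts of [u] lie in [L], by induction, and so does their
   difference, a nonzero multiple of [u]. *)
Lemma stable_component L rs ss u v :
  {in L, forall y, D y \in L} -> ~~ has [in ss] rs ->
  shifts rs u = 0 -> shifts ss v = 0 -> u + v \in L -> u \in L.
Proof.
move=> DL; elim: rs ss u v => [|r rs IHrs] ss u v neq ku kv uvL.
  by move: ku => /= ->; rewrite mem0v.
have shL t w : w \in L -> D w - t *: w \in L.
  by move=> wL; rewrite memvB ?memvZ ?DL.
have shD t x y : D (x + y) - t *: (x + y) = (D x - t *: x) + (D y - t *: y).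
  by rewrite linearD /= scalerDr opprD addrACA.
elim: ss u v neq ku kv uvL => [|s ss IHss] u v neq ku kv uvL.
  by move: uvL kv => /= /[swap] ->; rewrite addr0.
have ruL : D u - r *: u \in L.
  apply: (IHrs (s :: ss) _ (D v - r *: v)) => [| | |].
  - by move: neq; rewrite /= negb_or => /andP[].
  - exact: ku.
  - by rewrite shifts_comm kv linear0 scaler0 subr0.
  - by rewrite -shD shL.
have suL : D u - s *: u \in L.
  apply: (IHss _ (D v - s *: v)) => [| | |].
  - by move: neq; apply/contra/sub_has => t /= tss; rewrite inE tss orbT.
  - by rewrite shifts_comm ku linear0 scaler0 subr0.
  - exact: kv.
  - by rewrite -shD shL.
have neqrs : r - s != 0.
  by move: neq; rewrite /= inE subr_eq0; case: (r == s).
rewrite -(scalerK neqrs u) memvZ //.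
suff -> : (r - s) *: u = (D u - s *: u) - (D u - r *: u) by exact: memvB.
by rewrite scalerBl opprB [RHS]addrC addrA subrK.
Qed.

End StableComponent.

(** * Symplectic conjugation *)

Section Symplectic.
Variable F : fieldType.
Implicit Types (g X Y : 'M[F]_4) (L : {vspace 'M[F]_4}).

Lemma J_sqr : J F *m J F = - 1%:M.
Proof.
rewrite J_mx4 (mx4_eta (- _)); mx4_compute;
  by rewrite !mxE ?(inj_eq val_inj) -?val_eqE /= ?inordK //=; ring.
Qed.

Lemma mulJJ n (M : 'M[F]_(n, 4)) : M *m J F *m J F = - M.
Proof. by rewrite -mulmxA J_sqr mulmxN mulmx1. Qed.

Lemma J_unit : J F \in unitmx.
Proof.
have : J F *m (- J F) = 1%:M by rewrite mulmxN J_sqr opprK.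
by case/mulmx1_unit.
Qed.

(** As [J] is invertible, the equation $gJg^t = J$ already forces [g] to be invertible. *)
Lemma Sp4P g : reflect (g *m J F *m g^T = J F) (g \in @Sp4 F).
Proof.
apply: (iffP andP) => [[_ /eqP //]|gJ]; split; last exact/eqP.
have : g *m (J F *m g^T) \in unitmx by rewrite mulmxA gJ J_unit.
by rewrite unitmx_mul => /andP[].
Qed.

Lemma Sp4_unit g : g \in @Sp4 F -> g \in unitmx.
Proof. by case/andP. Qed.

Lemma Sp4_mul g h : g \in @Sp4 F -> h \in @Sp4 F -> g *m h \in @Sp4 F.
Proof.
move=> /Sp4P gJ /Sp4P hJ; apply/Sp4P.
by rewrite trmx_mul mulmxA -(mulmxA g) -(mulmxA g) hJ.
Qed.

Lemma Sp4_inv g : g \in @Sp4 F -> invmx g \in @Sp4 F.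
Proof.
move=> gSp; have ug := Sp4_unit gSp; move/Sp4P: gSp => gJ; apply/Sp4P.
rewrite -[in LHS]gJ trmx_inv !mulmxA mulVmx // mul1mx.
by rewrite -mulmxA mulmxV ?unitmx_tr // mulmx1.
Qed.

(** From $gJg^t = J$ follow $J(g^t)^{-1} = gJ$ and $g^tJ = Jg^{-1}$, which turn $J(gXg^{-1})^tJ$
    into $g(JX^tJ)g^{-1}$. *)
Lemma sp4_conj g X :
  g \in @Sp4 F -> X \in @sp4 F -> g *m X *m invmx g \in @sp4 F.
Proof.
move=> gSp /eqP XJ; have ug := Sp4_unit gSp; move/Sp4P: gSp => gJ; apply/eqP.
rewrite -[in RHS]XJ !trmx_mul trmx_inv.
have -> : J F *m (invmx g^T *m (X^T *m g^T)) *m J F =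
  (J F *m invmx g^T) *m X^T *m (g^T *m J F) by rewrite !mulmxA.
have -> : J F *m invmx g^T = g *m J F.
  by rewrite -[in LHS]gJ mulmxK // unitmx_tr.
suff -> : g^T *m J F = J F *m invmx g by rewrite !mulmxA.
apply: (can_inj (mulKmx J_unit)); apply: (can_inj (mulKmx ug)).
by rewrite !mulmxA gJ !mulJJ mulNmx mulmxV // J_sqr.
Qed.

Lemma sp4_equiv_refl L : sp4_equiv L L.
Proof.
exists 1%:M; first by apply/Sp4P; rewrite trmx1 mulmx1 mul1mx.
move=> Y; split=> [YL|[X XL ->]]; first exists Y => //;
  by rewrite invmx1 mulmx1 mul1mx.
Qed.

Lemma sp4_equiv_sym L L' : sp4_equiv L L' -> sp4_equiv L' L.
Proof.
case=> g gSp LL'; exists (invmx g); first exact: Sp4_inv.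
have ug := Sp4_unit gSp.
move=> X; split=> [XL|[_ /LL'[Z ZL ->] ->]].
  exists (g *m X *m invmx g); first by apply/LL'; exists X.
  by rewrite invmxK !mulmxA mulVmx // mul1mx mulmxKV.
by rewrite invmxK !mulmxA mulVmx // mul1mx mulmxKV.
Qed.

Lemma sp4_equiv_trans L L' L'' :
  sp4_equiv L L' -> sp4_equiv L' L'' -> sp4_equiv L L''.
Proof.
move=> [g gSp gL] [h hSp hL]; exists (h *m g); first exact: Sp4_mul.
have -> : invmx (h *m g) = invmx g *m invmx h.
  by apply: (@invrM 'M_4); apply: Sp4_unit.
move=> Z; rewrite hL; split=> [[_ /gL[X XL ->] ->]|[X XL ->]].
  by exists X; rewrite // !mulmxA.
exists (g *m X *m invmx g); first by apply/gL; exists X.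
by rewrite !mulmxA.
Qed.

Definition conjv g L : {vspace 'M[F]_4} :=
  (linfun (mulmxr (invmx g) \o mulmx g) @: L)%VS.

Lemma conjvP g L Y :
  reflect (exists2 X, X \in L & Y = g *m X *m invmx g) (Y \in conjv g L).
Proof.
by apply: (iffP memv_imgP) => -[X XL ->]; exists X; rewrite // lfunE.
Qed.

Lemma mem_conjv g L X : X \in L -> g *m X *m invmx g \in conjv g L.
Proof. by move=> XL; apply/conjvP; exists X. Qed.

Lemma dim_conjv g L : g \in unitmx -> \dim (conjv g L) = \dim L.
Proof.
move=> ug; apply: limg_dim_eq; apply/eqP; rewrite -subv0; apply/subvP => X.
rewrite memv_cap memv_ker lfunE /= => /andP[_ /eqP gX].
by rewrite memv0 -[X](mulKmx ug) -[g *m X](mulmxKV ug) gX mul0mx mulmx0.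
Qed.

Lemma sp4_equiv_conjv g L : g \in @Sp4 F -> sp4_equiv L (conjv g L).
Proof. by move=> gSp; exists g => // Y; split=> /conjvP. Qed.

(** Conjugation preserves dimension, so an inclusion checked on generators is an equality. The form
    $gX = Yg$ spares computing the inverse of an explicit [g]. *)
Lemma sp4_equiv_span g s s' : g *m J F *m g^T = J F ->
  free s -> free s' -> size s = size s' ->
  {in s, forall X, exists2 Y, Y \in <<s'>>%VS & g *m X = Y *m g} ->
  sp4_equiv <<s>> <<s'>>.
Proof.
move=> /Sp4P gSp frs frs' sz ss'; have ug := Sp4_unit gSp.
suff <- : conjv g <<s>> = <<s'>>%VS by apply: sp4_equiv_conjv.
apply/eqP; rewrite eqEdim dim_conjv // (eqP frs) (eqP frs') sz leqnn andbT.
rewrite /conjv limg_span; apply/span_subvP => _ /mapP[X /ss'[Y Ys' gX] ->].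
by rewrite lfunE /= gX mulmxK.
Qed.

End Symplectic.

Ltac sp_compute :=
  repeat (first [rewrite sp_bracket | rewrite sp_mxZ | rewrite sp_mxN
                | rewrite sp_mxD]);
  rewrite -?sp_mx0; congr sp_mx.

(** * Subalgebras containing a normal form *)

Section Classification.
Variable F : numClosedFieldType.
Implicit Types (L : {vspace 'M[F]_4}).

Lemma bracket_T11 (a b c d e f h k l m : F) :
  lie_bracket (sp_mx 1 1 0 1 0 0 0 0 0 0) (sp_mx a b c d e f h k l m) =
  sp_mx c (d - a) 0 (- c) (2 * e + 2 * f) (2 * f + h) (2 * h)
        (- (2 * k)) (- (2 * l) - k) (- (2 * m) - 2 * l).
Proof. by sp_compute; ring. Qed.

Lemma bracket_T10 (a b c d e f h k l m : F) :
  lie_bracket (sp_mx 1 0 0 0 0 0 1 0 0 0) (sp_mx a b c d e f h k l m) =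
  sp_mx 0 b (l - c) m (2 * e) (f - b) (- (2 * d)) (- (2 * k)) (- l) 0.
Proof. by sp_compute; ring. Qed.

Lemma shift_T11 (r a b c d e f h k l m : F) :
  lie_bracket (sp_mx 1 1 0 1 0 0 0 0 0 0) (sp_mx a b c d e f h k l m)
    - r *: sp_mx a b c d e f h k l m =
  sp_mx (c - r * a) (d - a - r * b) (- r * c) (- c - r * d)
    ((2 - r) * e + 2 * f) ((2 - r) * f + h) ((2 - r) * h)
    (- (2 + r) * k) (- (2 + r) * l - k) (- (2 + r) * m - 2 * l).
Proof. by rewrite bracket_T11; sp_compute; ring. Qed.

Lemma shift_T10 (r a b c d e f h k l m : F) :
  lie_bracket (sp_mx 1 0 0 0 0 0 1 0 0 0) (sp_mx a b c d e f h k l m)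
    - r *: sp_mx a b c d e f h k l m =
  sp_mx (- r * a) ((1 - r) * b) (l - (1 + r) * c) (m - r * d)
    ((2 - r) * e) ((1 - r) * f - b) (- (2 * d) - r * h)
    (- (2 + r) * k) (- (1 + r) * l) (- r * m).
Proof. by rewrite bracket_T10; sp_compute; ring. Qed.

Let two_neq0 : (2 : F) != 0. Proof. by rewrite pnatr_eq0. Qed.
Let oneN1 : (1 == -1 :> F) = false.
Proof. by rewrite -addr_eq0 (negPf two_neq0). Qed.
Let twoN2 : (2 == -2 :> F) = false.
Proof. by rewrite -addr_eq0 -natrD pnatr_eq0. Qed.
Let twoN1 : (2 == -1 :> F) = false.
Proof. by rewrite -addr_eq0 -(natrD _ 2 1) pnatr_eq0. Qed.
Let oneN2 : (1 == -2 :> F) = false.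
Proof. by rewrite -addr_eq0 -(natrD _ 1 2) pnatr_eq0. Qed.
Let one2 : (1 == 2 :> F) = false.
Proof. by rewrite (eqr_nat _ 1 2). Qed.
(** In characteristic 0 the weights 0, 1, -1, 2, -2 are distinct; this table decides the
    disjointness conditions of [stable_component]. *)
Let weights_neq := (eqr_opp, oppr_eq0, oner_eq0, negPf two_neq0,
  eq_sym (0 : F), eq_sym (-1 : F) 1,
  eq_sym (-1 : F) 2, eq_sym (-2 : F) 1, eq_sym (-2 : F) 2, eq_sym (2 : F) 1,
  oneN1, twoN2, twoN1, oneN2, one2).

(* The parts are the eigenspaces of ad T_{1,1} for 0, 2 and -2. *)
Lemma T11_components L (a b c d e f h k l m : F) :
  {in L, forall Y, lie_bracket (sp_mx 1 1 0 1 0 0 0 0 0 0) Y \in L} ->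
  sp_mx a b c d e f h k l m \in L ->
  [/\ sp_mx a b c d 0 0 0 0 0 0 \in L,
      sp_mx 0 0 0 0 e f h 0 0 0 \in L
    & sp_mx 0 0 0 0 0 0 0 k l m \in L].
Proof.
move=> stL YL; pose D := lie_bracket (sp_mx 1 1 0 1 0 0 0 0 0 (0 : F)).
(* On each part [D] minus its weight has cube zero, hence three shifts per weight. *)
have K0 : shifts D [:: 0; 0; 0] (sp_mx a b c d 0 0 0 0 0 0) = 0.
  by rewrite /shifts /= !shift_T11 -sp_mx0; congr sp_mx; ring.
have K2 : shifts D [:: 2; 2; 2] (sp_mx 0 0 0 0 e f h 0 0 0) = 0.
  by rewrite /shifts /= !shift_T11 -sp_mx0; congr sp_mx; ring.
have KN2 : shifts D [:: -2; -2; -2] (sp_mx 0 0 0 0 0 0 0 k l m) = 0.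
  by rewrite /shifts /= !shift_T11 -sp_mx0; congr sp_mx; ring.
split; [ apply: (stable_component stL _ K0 (shifts_cat_eq0 K2 KN2))
       | apply: (stable_component stL _ K2 (shifts_cat_eq0 K0 KN2))
       | apply: (stable_component stL _ KN2 (shifts_cat_eq0 K0 K2)) ];
  by rewrite ?(sp_mxD, addr0, add0r) //= !inE !weights_neq.
Qed.

(* The parts are the eigenspaces of ad T_{1,0} for 0, 1, 2, -1 and -2. *)
Lemma T10_components L (a b c d e f h k l m : F) :
  {in L, forall Y, lie_bracket (sp_mx 1 0 0 0 0 0 1 0 0 0) Y \in L} ->
  sp_mx a b c d e f h k l m \in L ->
  [/\ sp_mx a 0 0 d 0 0 h 0 0 m \in L,
      sp_mx 0 b 0 0 0 f 0 0 0 0 \in L /\ sp_mx 0 0 0 0 e 0 0 0 0 0 \in L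
    & sp_mx 0 0 c 0 0 0 0 0 l 0 \in L /\ sp_mx 0 0 0 0 0 0 0 k 0 0 \in L].
Proof.
move=> stL YL; pose D := lie_bracket (sp_mx 1 0 0 0 0 0 1 0 0 (0 : F)).
(* The multiplicity of each weight bounds the nilpotency index of [D] minus that weight: 3 for 0, 2
   for 1 and -1, and 1 for 2 and -2. *)
have K0 : shifts D [:: 0; 0; 0] (sp_mx a 0 0 d 0 0 h 0 0 m) = 0.
  by rewrite /shifts /= !shift_T10 -sp_mx0; congr sp_mx; ring.
have K1 : shifts D [:: 1; 1] (sp_mx 0 b 0 0 0 f 0 0 0 0) = 0.
  by rewrite /shifts /= !shift_T10 -sp_mx0; congr sp_mx; ring.
have K2 : shifts D [:: 2] (sp_mx 0 0 0 0 e 0 0 0 0 0) = 0.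
  by rewrite /shifts /= !shift_T10 -sp_mx0; congr sp_mx; ring.
have KN1 : shifts D [:: -1; -1] (sp_mx 0 0 c 0 0 0 0 0 l 0) = 0.
  by rewrite /shifts /= !shift_T10 -sp_mx0; congr sp_mx; ring.
have KN2 : shifts D [:: -2] (sp_mx 0 0 0 0 0 0 0 k 0 0) = 0.
  by rewrite /shifts /= !shift_T10 -sp_mx0; congr sp_mx; ring.
split; [| split | split];
  [ apply: (stable_component stL _ K0 (shifts_cat_eq0 K1
      (shifts_cat_eq0 K2 (shifts_cat_eq0 KN1 KN2))))
  | apply: (stable_component stL _ K1 (shifts_cat_eq0 K0
      (shifts_cat_eq0 K2 (shifts_cat_eq0 KN1 KN2))))
  | apply: (stable_component stL _ K2 (shifts_cat_eq0 K0
      (shifts_cat_eq0 K1 (shifts_cat_eq0 KN1 KN2))))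
  | apply: (stable_component stL _ KN1 (shifts_cat_eq0 K0
      (shifts_cat_eq0 K1 (shifts_cat_eq0 K2 KN2))))
  | apply: (stable_component stL _ KN2 (shifts_cat_eq0 K0
      (shifts_cat_eq0 K1 (shifts_cat_eq0 K2 KN1)))) ];
  by rewrite ?(sp_mxD, addr0, add0r) //= !inE !weights_neq.
Qed.

End Classification.

(** * The listed algebras in coordinates *)

Section Listed.
Variable F : fieldType.

Let coordE := (T_sp, X_a_sp, X_b_sp, X_ab_sp, X_a2b_sp, sp_mxD, addr0, add0r).

Lemma L1E : @L1 F = <<[:: sp_mx 1 1 0 1 0 0 0 0 0 0;
  sp_mx 0 0 0 0 0 1 0 0 0 0; sp_mx 0 0 0 0 1 0 0 0 0 0]>>%VS.
Proof. by rewrite /L1 !coordE. Qed.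

Lemma L1'E : @L1' F = <<[:: sp_mx 1 0 0 (-1) 0 1 0 0 0 0;
  sp_mx 0 1 0 0 0 0 0 0 0 0; sp_mx 0 0 0 0 1 0 0 0 0 0]>>%VS.
Proof. by rewrite /L1' !coordE. Qed.

Lemma L2E : @L2 F = <<[:: sp_mx 1 0 0 (-1) 0 1 0 0 0 0;
  sp_mx 0 0 0 0 0 0 1 0 0 0; sp_mx 0 0 0 0 1 0 0 0 0 0]>>%VS.
Proof. by rewrite /L2 !coordE. Qed.

Lemma L3E : @L3 F = <<[:: sp_mx 1 0 0 0 0 0 1 0 0 0;
  sp_mx 0 0 0 0 0 1 0 0 0 0; sp_mx 0 0 0 0 1 0 0 0 0 0]>>%VS.
Proof. by rewrite /L3 !coordE. Qed.

Lemma L3'E : @L3' F = <<[:: sp_mx 0 0 0 1 1 0 0 0 0 0;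
  sp_mx 0 0 0 0 0 0 1 0 0 0; sp_mx 0 0 0 0 0 1 0 0 0 0]>>%VS.
Proof. by rewrite /L3' !coordE. Qed.

End Listed.

Ltac free_sp :=
  let k := fresh "k" in
  apply: free_coefs => k;
  rewrite /= !big_ord_recr big_ord0 /= !sp_mxZ ?sp_mxD -sp_mx0
    !(sp_mxD, mulr0, mulr1, addr0, add0r);
  case/sp_mx_inj => -[? ? ? ?] [? ? ?] [? ? ?];
  by do 4?[case=> //].

Ltac span3_sp a b c :=
  apply/span3P; exists a, b, c;
  rewrite !(sp_mxZ, sp_mxD); congr sp_mx; ring.

(** * Explicit symplectic conjugations *)

Section Equivalences.
Variable F : numClosedFieldType.

(** Represents the reflection in the long root alpha: conjugation by it exchanges $T_{a,b}$ and
    $T_{a,-b}$. *)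
Definition swap24 : 'M[F]_4 := mx4 [:: [:: 1; 0; 0; 0]; [:: 0; 0; 0; -1];
                                       [:: 0; 0; 1; 0]; [:: 0; 1; 0; 0]].

Lemma swap24_Sp4 : swap24 *m J F *m swap24^T = J F.
Proof. by rewrite /swap24; mx4_compute; ring. Qed.

Lemma L1_equiv_L1' : @sp4_equiv F L1 L1'.
Proof.
rewrite L1E L1'E; apply: (sp4_equiv_span swap24_Sp4); try by free_sp.
  by [].
move=> X; rewrite !inE => /or3P[] /eqP ->.
- exists (sp_mx 1 0 0 (-1) 0 1 0 0 0 0).
    by span3_sp (1 : F) (0 : F) (0 : F).
  by rewrite /swap24; mx4_compute; ring.
- exists (sp_mx 0 (-1) 0 0 0 0 0 0 0 0).
    by span3_sp (0 : F) (-1 : F) (0 : F).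
  by rewrite /swap24; mx4_compute; ring.
- exists (sp_mx 0 0 0 0 1 0 0 0 0 0).
    by span3_sp (0 : F) (0 : F) (1 : F).
  by rewrite /swap24; mx4_compute; ring.
Qed.

(** Covers the algebra with one root vector of degree 2 and one of degree -2 under $T_{1,1}$; the
    reflection sends $E_{42}$ to [- X_a]. *)
Lemma equiv_L2 : sp4_equiv <<[:: sp_mx 1 1 0 1 0 0 0 0 0 0;
  sp_mx 0 0 0 0 1 0 0 0 0 0; sp_mx 0 0 0 0 0 0 0 0 0 1]>> (@L2 F).
Proof.
rewrite L2E; apply: (sp4_equiv_span swap24_Sp4); try by free_sp.
  by [].
move=> X; rewrite !inE => /or3P[] /eqP ->.
- exists (sp_mx 1 0 0 (-1) 0 1 0 0 0 0).
    by span3_sp (1 : F) (0 : F) (0 : F).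
  by rewrite /swap24; mx4_compute; ring.
- exists (sp_mx 0 0 0 0 1 0 0 0 0 0).
    by span3_sp (0 : F) (0 : F) (1 : F).
  by rewrite /swap24; mx4_compute; ring.
- exists (sp_mx 0 0 0 0 0 0 (-1) 0 0 0).
    by span3_sp (0 : F) (-1 : F) (0 : F).
  by rewrite /swap24; mx4_compute; ring.
Qed.

(** Covers the algebra with two dimensions in degree -2: conjugation by [g] negates $T_{1,1} +
    X_\beta$, and so exchanges the degrees 2 and -2. *)
Lemma equiv_L1 : sp4_equiv <<[:: sp_mx 1 1 0 1 0 0 0 0 0 0;
  sp_mx 0 0 0 0 0 0 0 0 1 0; sp_mx 0 0 0 0 0 0 0 0 0 1]>> (@L1 F).
Proof.
pose g : 'M[F]_4 := mx4 [:: [:: 0; 0; 0; 1]; [:: 0; 0; 1; 0];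
                            [:: 0; -1; 0; 0]; [:: -1; 0; 0; 0]].
have gSp : g *m J F *m g^T = J F by rewrite /g; mx4_compute; ring.
rewrite L1E; apply: (sp4_equiv_span gSp); try by free_sp.
  by [].
move=> X; rewrite !inE => /or3P[] /eqP ->.
- exists (sp_mx (-1) (-1) 0 (-1) 0 0 0 0 0 0).
    by span3_sp (-1 : F) (0 : F) (0 : F).
  by rewrite /g; mx4_compute; ring.
- exists (sp_mx 0 0 0 0 0 (-1) 0 0 0 0).
    by span3_sp (0 : F) (-1 : F) (0 : F).
  by rewrite /g; mx4_compute; ring.
- exists (sp_mx 0 0 0 0 (-1) 0 0 0 0 0).
    by span3_sp (0 : F) (0 : F) (-1 : F).
  by rewrite /g; mx4_compute; ring.
Qed.

Lemma L3_equiv_L3' : @sp4_equiv F L3 L3'.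
Proof.
(* The permutation of the two coordinate pairs, which exchanges $T_{a,b}$ and $T_{b,a}$. *)
pose g : 'M[F]_4 := mx4 [:: [:: 0; 1; 0; 0]; [:: 1; 0; 0; 0];
                            [:: 0; 0; 0; 1]; [:: 0; 0; 1; 0]].
have gSp : g *m J F *m g^T = J F by rewrite /g; mx4_compute; ring.
rewrite L3E L3'E; apply: (sp4_equiv_span gSp); try by free_sp.
  by [].
move=> X; rewrite !inE => /or3P[] /eqP ->.
- exists (sp_mx 0 0 0 1 1 0 0 0 0 0).
    by span3_sp (1 : F) (0 : F) (0 : F).
  by rewrite /g; mx4_compute; ring.
- exists (sp_mx 0 0 0 0 0 1 0 0 0 0).
    by span3_sp (0 : F) (0 : F) (1 : F).
  by rewrite /g; mx4_compute; ring.
- exists (sp_mx 0 0 0 0 0 0 1 0 0 0).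
    by span3_sp (0 : F) (1 : F) (0 : F).
  by rewrite /g; mx4_compute; ring.
Qed.

Lemma equiv_L3 : sp4_equiv <<[:: sp_mx 1 0 0 0 0 0 1 0 0 0;
  sp_mx 0 0 1 0 0 0 0 0 0 0; sp_mx 0 0 0 0 0 0 0 1 0 0]>> (@L3 F).
Proof.
(* The rotation of coordinates 1 and 3 negates $T_{1,0}$. To negate $X_\alpha$ as well, coordinates
   2 and 4 are scaled by $t$ and $-t$, which is symplectic exactly when $-t^2 = 1$. *)
pose t : F := 'i; have tt : t ^+ 2 = -1 by apply: sqrCi.
pose g : 'M[F]_4 := mx4 [:: [:: 0; 0; 1; 0]; [:: 0; t; 0; 0];
                            [:: -1; 0; 0; 0]; [:: 0; 0; 0; -t]].
have gSp : g *m J F *m g^T = J F by rewrite /g; mx4_compute; ring: tt.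
rewrite L3E; apply: (sp4_equiv_span gSp); try by free_sp.
  by [].
move=> X; rewrite !inE => /or3P[] /eqP ->.
- exists (sp_mx (-1) 0 0 0 0 0 (-1) 0 0 0).
    by span3_sp (-1 : F) (0 : F) (0 : F).
  by rewrite /g; mx4_compute; ring: tt.
- exists (sp_mx 0 0 0 0 0 (- t) 0 0 0 0).
    by span3_sp (0 : F) (- t : F) (0 : F).
  by rewrite /g; mx4_compute; ring: tt.
- exists (sp_mx 0 0 0 0 (-1) 0 0 0 0 0).
    by span3_sp (0 : F) (0 : F) (-1 : F).
  by rewrite /g; mx4_compute; ring: tt.
Qed.

End Equivalences.

(** * Three-dimensional subalgebras through a normal form *)

Section Subalgebras.
Variable F : numClosedFieldType.
Implicit Types (L : {vspace 'M[F]_4}).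

Lemma memvZ_inv (L : {vspace 'M[F]_4}) c v : c != 0 -> c *: v \in L -> v \in L.
Proof. by move=> c0; rewrite -{2}[v](scalerK c0); apply: memvZ. Qed.

Let two_neq0 : (2 : F) != 0. Proof. by rewrite pnatr_eq0. Qed.

(** Only the line of [X0] survives in degree 0. In degrees 2 and -2 the nilpotent part of ad [X0]
    acts by a single string of length 3, so the possible parts there are determined by their
    dimensions. *)
Lemma T11_subalgebra L :
  sp4_subalgebra L -> \dim L = 3%N -> sp_mx 1 0 0 1 0 0 0 0 0 0 \notin L ->
  sp_mx 1 1 0 1 0 0 0 0 0 0 \in L -> sp4_equiv L L1 \/ sp4_equiv L L2.
Proof.
move=> [Lsp Lbr] dimL nT XL.
set X0 := sp_mx _ _ _ _ _ _ _ _ _ _ in XL.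
have stL : {in L, forall Y, lie_bracket X0 Y \in L} by move=> Y; apply: Lbr.
have shL r Y : Y \in L -> lie_bracket X0 Y - r *: Y \in L.
  by move=> YL; rewrite memvB ?memvZ ?stL.
(* Otherwise the semisimple part $T_{1,1}$ of [X0] would lie in [L]. *)
have nb : sp_mx 0 1 0 0 0 0 0 0 0 0 \notin L.
  apply: contra nT => bL; suff -> : sp_mx 1 0 0 1 0 0 0 0 0 0 =
    X0 - sp_mx 0 1 0 0 0 0 0 0 0 0 :> 'M[F]_4 by rewrite memvB.
  by rewrite /X0; sp_compute; ring.
(* Any degree 0 element off the line of [X0] yields a nonzero multiple of $X_\beta$, by applying ad
   [X0] or subtracting a multiple of [X0]. *)
have diagL a b c d :
    sp_mx a b c d 0 0 0 0 0 0 \in L -> [/\ c = 0, d = a & b = a].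
  move=> YL.
  have c0 : c = 0.
    apply/eqP; apply: contraNT nb => nc; apply: (@memvZ_inv _ (- 2 * c)).
      by rewrite mulf_neq0 ?oppr_eq0.
    move: (shL 0 _ (shL 0 _ YL)); rewrite /X0 !shift_T11.
    by congr (_ \in L); sp_compute; ring.
  have da : d = a.
    apply/eqP; rewrite -subr_eq0; apply: contraNT nb => nd.
    apply: (memvZ_inv nd); move: (shL 0 _ YL); rewrite /X0 !shift_T11 c0.
    by congr (_ \in L); sp_compute; ring.
  split=> //; apply/eqP; rewrite -subr_eq0; apply: contraNT nb => nba.
  apply: (memvZ_inv nba); move: (memvB YL (memvZ a XL)); rewrite c0 da.
  by congr (_ \in L); rewrite /X0; sp_compute; ring.
(* The string is $X_\alpha \to X_{\alpha+\beta} \to X_{\alpha+2\beta}$ up to scalars. A nonzero [h]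
   would bring in all three and, with [X0], dimension 4. *)
have upL e f h : sp_mx 0 0 0 0 e f h 0 0 0 \in L ->
    h = 0 /\ (f != 0 -> sp_mx 0 0 0 0 0 1 0 0 0 0 \in L /\
                        sp_mx 0 0 0 0 1 0 0 0 0 0 \in L).
  have fL e' f' : f' != 0 -> sp_mx 0 0 0 0 e' f' 0 0 0 0 \in L ->
      sp_mx 0 0 0 0 0 1 0 0 0 0 \in L /\ sp_mx 0 0 0 0 1 0 0 0 0 0 \in L.
    move=> nf YL; have eL : sp_mx 0 0 0 0 1 0 0 0 0 0 \in L.
      apply: (@memvZ_inv _ (2 * f')); first by rewrite mulf_neq0.
      move: (shL 2 _ YL); rewrite /X0 shift_T11.
      by congr (_ \in L); sp_compute; ring.
    split=> //; apply: (memvZ_inv nf); move: (memvB YL (memvZ e' eL)).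
    by congr (_ \in L); sp_compute; ring.
  move=> YL; suff h0 : h = 0.
    by split=> //; move: YL; rewrite h0 => YL /fL/(_ YL).
  apply/eqP; apply/negPn/negP => nh.
  have [fL' eL] : sp_mx 0 0 0 0 0 1 0 0 0 0 \in L /\
      sp_mx 0 0 0 0 1 0 0 0 0 0 \in L.
    apply: (fL (2 * f) h) => //; move: (shL 2 _ YL); rewrite /X0 shift_T11.
    by congr (_ \in L); sp_compute; ring.
  have hL : sp_mx 0 0 0 0 0 0 1 0 0 0 \in L.
    apply: (memvZ_inv nh); move: (memvB (memvB YL (memvZ e eL)) (memvZ f fL')).
    by congr (_ \in L); sp_compute; ring.
  suff : (4 <= \dim L)%N by rewrite dimL.
  apply: (@free_subset_leq _ _ [:: X0; sp_mx 0 0 0 0 0 0 1 0 0 0;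
    sp_mx 0 0 0 0 0 1 0 0 0 0; sp_mx 0 0 0 0 1 0 0 0 0 0]).
    by rewrite /X0; free_sp.
  by move=> Y; rewrite !inE => /or4P[] /eqP ->.
(* The same for the string of negative root vectors. *)
have downL k l m : sp_mx 0 0 0 0 0 0 0 k l m \in L ->
    k = 0 /\ (l != 0 -> sp_mx 0 0 0 0 0 0 0 0 1 0 \in L /\
                        sp_mx 0 0 0 0 0 0 0 0 0 1 \in L).
  have lL l' m' : l' != 0 -> sp_mx 0 0 0 0 0 0 0 0 l' m' \in L ->
      sp_mx 0 0 0 0 0 0 0 0 1 0 \in L /\ sp_mx 0 0 0 0 0 0 0 0 0 1 \in L.
    move=> nl YL; have mL : sp_mx 0 0 0 0 0 0 0 0 0 1 \in L.
      apply: (@memvZ_inv _ (- 2 * l')); first by rewrite mulf_neq0 ?oppr_eq0.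
      move: (shL (- 2) _ YL); rewrite /X0 shift_T11.
      by congr (_ \in L); sp_compute; ring.
    split=> //; apply: (memvZ_inv nl); move: (memvB YL (memvZ m' mL)).
    by congr (_ \in L); sp_compute; ring.
  move=> YL; suff k0 : k = 0.
    by split=> //; move: YL; rewrite k0 => YL /lL/(_ YL).
  apply/eqP; apply/negPn/negP => nk.
  have [lL' mL] : sp_mx 0 0 0 0 0 0 0 0 1 0 \in L /\
      sp_mx 0 0 0 0 0 0 0 0 0 1 \in L.
    apply: (lL (- k) (- 2 * l)); first by rewrite oppr_eq0.
    move: (shL (- 2) _ YL); rewrite /X0 shift_T11.
    by congr (_ \in L); sp_compute; ring.
  have kL : sp_mx 0 0 0 0 0 0 0 1 0 0 \in L.
    apply: (memvZ_inv nk); move: (memvB (memvB YL (memvZ l lL')) (memvZ m mL)).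
    by congr (_ \in L); sp_compute; ring.
  suff : (4 <= \dim L)%N by rewrite dimL.
  apply: (@free_subset_leq _ _ [:: X0; sp_mx 0 0 0 0 0 0 0 1 0 0;
    sp_mx 0 0 0 0 0 0 0 0 1 0; sp_mx 0 0 0 0 0 0 0 0 0 1]).
    by rewrite /X0; free_sp.
  by move=> Y; rewrite !inE => /or4P[] /eqP ->.
have coordL Y : Y \in L -> exists a e f l m,
    [/\ Y = sp_mx a a 0 a e f 0 0 l m,
        sp_mx 0 0 0 0 e f 0 0 0 0 \in L & sp_mx 0 0 0 0 0 0 0 0 l m \in L].
  move=> YL; have := sp4_sp_mx (Lsp _ YL).
  move=> [a [b [c [d [e [f [h [k [l [m EY]]]]]]]]]].
  move: YL; rewrite {}EY => /(T11_components stL)[/diagL[-> -> ->] uL dL].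
  have [h0 _] := upL _ _ _ uL; have [k0 _] := downL _ _ _ dL.
  by move: uL dL; rewrite h0 k0 => uL dL; exists a, e, f, l, m.
have [[e [f [fL nf]]]|nof] :=
  EM (exists e f, sp_mx 0 0 0 0 e f 0 0 0 0 \in L /\ f != 0).
  left; have [_ /(_ nf)[abL a2bL]] := upL _ _ _ fL.
  suff -> : L = L1 by exact: sp4_equiv_refl.
  rewrite L1E; apply: free_subset_eq; rewrite ?dimL //; first by free_sp.
  by move=> Y; rewrite !inE => /or3P[] /eqP ->.
have [[l [m [lL nl]]]|nol] :=
  EM (exists l m, sp_mx 0 0 0 0 0 0 0 0 l m \in L /\ l != 0).
  left; have [_ /(_ nl)[lL' mL]] := downL _ _ _ lL.
  suff -> : L = <<[:: X0; sp_mx 0 0 0 0 0 0 0 0 1 0;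
    sp_mx 0 0 0 0 0 0 0 0 0 1]>>%VS by exact: equiv_L1.
  apply: free_subset_eq; rewrite ?dimL //; first by rewrite /X0; free_sp.
  by move=> Y; rewrite !inE => /or3P[] /eqP ->.
(* Each of the degrees 2 and -2 now contributes at most the end of its string. *)
right; suff -> : L = <<[:: X0; sp_mx 0 0 0 0 1 0 0 0 0 0;
    sp_mx 0 0 0 0 0 0 0 0 0 1]>>%VS by exact: equiv_L2.
apply: subset_span_eq; last by rewrite dimL.
move=> Y /coordL[a [e [f [l [m [-> fL lL]]]]]].
have -> : f = 0 by apply/eqP/negPn/negP => nf; apply: nof; exists e, f.
have -> : l = 0 by apply/eqP/negPn/negP => nl; apply: nol; exists l, m.
by rewrite /X0; span3_sp a e m.
Qed.

(** The degree 0 part reduces to the line of [X0]; the rest of [L] has either only positive or only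
    negative degrees, and these two cases are conjugate. *)
Lemma T10_subalgebra L :
  sp4_subalgebra L -> \dim L = 3%N -> sp_mx 1 0 0 0 0 0 0 0 0 0 \notin L ->
  sp_mx 1 0 0 0 0 0 1 0 0 0 \in L -> sp4_equiv L L3.
Proof.
move=> [Lsp Lbr] dimL nT XL.
set X0 := sp_mx _ _ _ _ _ _ _ _ _ _ in XL.
have stL : {in L, forall Y, lie_bracket X0 Y \in L} by move=> Y; apply: Lbr.
have shL r Y : Y \in L -> lie_bracket X0 Y - r *: Y \in L.
  by move=> YL; rewrite memvB ?memvZ ?stL.
pose eb : 'M[F]_4 := sp_mx 0 1 0 0 0 0 0 0 0 0.
pose ec : 'M[F]_4 := sp_mx 0 0 1 0 0 0 0 0 0 0.
pose ee : 'M[F]_4 := sp_mx 0 0 0 0 1 0 0 0 0 0.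
pose ef : 'M[F]_4 := sp_mx 0 0 0 0 0 1 0 0 0 0.
pose eh : 'M[F]_4 := sp_mx 0 0 0 0 0 0 1 0 0 0.
pose ek : 'M[F]_4 := sp_mx 0 0 0 0 0 0 0 1 0 0.
pose el : 'M[F]_4 := sp_mx 0 0 0 0 0 0 0 0 1 0.
have nh : eh \notin L.
  apply: contra nT => hL; suff -> : sp_mx 1 0 0 0 0 0 0 0 0 0 = X0 - eh.
    by rewrite memvB.
  by rewrite /X0 /eh; sp_compute; ring.
have diagL a d h m :
    sp_mx a 0 0 d 0 0 h 0 0 m \in L -> [/\ m = 0, d = 0 & h = a].
  move=> YL.
  have m0 : m = 0.
    apply/eqP; apply: contraNT nh => nm; apply: (@memvZ_inv _ (- 2 * m)).
      by rewrite mulf_neq0 ?oppr_eq0.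
    move: (shL 0 _ (shL 0 _ YL)); rewrite /X0 !shift_T10.
    by congr (_ \in L); rewrite /eh; sp_compute; ring.
  have d0 : d = 0.
    apply/eqP; apply: contraNT nh => nd; apply: (@memvZ_inv _ (- 2 * d)).
      by rewrite mulf_neq0 ?oppr_eq0.
    move: (shL 0 _ YL); rewrite /X0 !shift_T10 m0.
    by congr (_ \in L); rewrite /eh; sp_compute; ring.
  split=> //; apply/eqP; rewrite -subr_eq0; apply: contraNT nh => nha.
  apply: (memvZ_inv nha); move: (memvB YL (memvZ a XL)); rewrite m0 d0.
  by congr (_ \in L); rewrite /X0 /eh; sp_compute; ring.
(* Positive and negative degrees exclude each other: the brackets of such vectors lead to [eh] or to
   $T_{1,0}$, neither of which is in [L]. *)
have fcL : ef \in L -> ec \notin L.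
  move=> fL; apply: contra nh => cL; apply: (@memvZ_inv _ (- 2)).
    by rewrite oppr_eq0.
  move: (Lbr _ _ fL cL); congr (_ \in L); rewrite /ef /ec /eh.
  by sp_compute; ring.
have fkL : ef \in L -> ek \notin L.
  move=> fL; apply: contra (fcL fL) => kL; move: (Lbr _ _ fL kL).
  by congr (_ \in L); rewrite /ef /ec /ek; sp_compute; ring.
have ecL : ee \in L -> ec \notin L.
  move=> eL; apply/negP => cL; have: ef \in L.
    move: (Lbr _ _ cL eL); congr (_ \in L); rewrite /ef /ec /ee.
    by sp_compute; ring.
  by move=> /fcL/negP; apply.
have ekL : ee \in L -> ek \notin L.
  move=> eL; apply: contra nT => kL; move: (Lbr _ _ eL kL).
  by congr (_ \in L); rewrite /ee /ek; sp_compute; ring.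
(* The vector [eb] would bring in [ef] through ad [X0], then [ee] as a bracket, and so four
   independent elements with [X0]. *)
have bfL b f : sp_mx 0 b 0 0 0 f 0 0 0 0 \in L -> b = 0.
  move=> YL; apply/eqP; apply/negPn/negP => nb.
  have fL : ef \in L.
    apply: (@memvZ_inv _ (- b)); first by rewrite oppr_eq0.
    move: (shL 1 _ YL); rewrite /X0 shift_T10.
    by congr (_ \in L); rewrite /ef; sp_compute; ring.
  have bL : eb \in L.
    apply: (memvZ_inv nb); move: (memvB YL (memvZ f fL)).
    by congr (_ \in L); rewrite /ef /eb; sp_compute; ring.
  have eL : ee \in L.
    apply: (memvZ_inv two_neq0); move: (Lbr _ _ bL fL).
    by congr (_ \in L); rewrite /ef /eb /ee; sp_compute; ring.
  suff : (4 <= \dim L)%N by rewrite dimL.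
  apply: (@free_subset_leq _ _ [:: X0; eb; ef; ee]).
    by rewrite /X0 /eb /ef /ee; free_sp.
  by move=> Y; rewrite !inE => /or4P[] /eqP ->.
(* Likewise [el] would bring in [ec] and then [ek]. *)
have clL c l : sp_mx 0 0 c 0 0 0 0 0 l 0 \in L -> l = 0.
  move=> YL; apply/eqP; apply/negPn/negP => nl.
  have cL : ec \in L.
    apply: (memvZ_inv nl); move: (shL (-1) _ YL); rewrite /X0 shift_T10.
    by congr (_ \in L); rewrite /ec; sp_compute; ring.
  have lL : el \in L.
    apply: (memvZ_inv nl); move: (memvB YL (memvZ c cL)).
    by congr (_ \in L); rewrite /ec /el; sp_compute; ring.
  have kL : ek \in L.
    apply: (@memvZ_inv _ (- 2)); first by rewrite oppr_eq0.
    move: (Lbr _ _ cL lL).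
    by congr (_ \in L); rewrite /ec /el /ek; sp_compute; ring.
  suff : (4 <= \dim L)%N by rewrite dimL.
  apply: (@free_subset_leq _ _ [:: X0; ec; el; ek]).
    by rewrite /X0 /ec /el /ek; free_sp.
  by move=> Y; rewrite !inE => /or4P[] /eqP ->.
have coordL Y : Y \in L -> exists a c e f k,
    [/\ Y = sp_mx a 0 c 0 e f a k 0 0, (f != 0 -> ef \in L),
        (e != 0 -> ee \in L), (c != 0 -> ec \in L) & (k != 0 -> ek \in L)].
  move=> YL; have := sp4_sp_mx (Lsp _ YL).
  move=> [a [b [c [d [e [f [h [k [l [m EY]]]]]]]]]].
  move: YL; rewrite {}EY.
  move=> /(T10_components stL)[/diagL[-> -> ->] [bL eL] [cL kL]].
  have b0 := bfL _ _ bL; have l0 := clL _ _ cL.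
  move: bL cL; rewrite b0 l0 => fL cL.
  exists a, c, e, f, k; split=> // nz; apply: (memvZ_inv nz).
  - by move: fL; congr (_ \in L); rewrite /ef; sp_compute; ring.
  - by move: eL; congr (_ \in L); rewrite /ee; sp_compute; ring.
  - by move: cL; congr (_ \in L); rewrite /ec; sp_compute; ring.
  - by move: kL; congr (_ \in L); rewrite /ek; sp_compute; ring.
(* The two cases are positive degrees, which give [L3] itself, and negative degrees. *)
have [efL|] := boolP ((ee \in L) || (ef \in L)).
  suff -> : L = L3 by exact: sp4_equiv_refl.
  rewrite L3E; apply: subset_span_eq; last by rewrite dimL.
  have nc : ec \notin L by case/orP: efL => [/ecL|/fcL].
  have nk : ek \notin L by case/orP: efL => [/ekL|/fkL].
  move=> Y /coordL[a [c [e [f [k [-> _ _]]]]]].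
  move=> /contraNeq/(_ nc)-> /contraNeq/(_ nk)->.
  by span3_sp a f e.
rewrite negb_or => /andP[ne nf].
suff -> : L = <<[:: X0; ec; ek]>>%VS by exact: equiv_L3.
apply: subset_span_eq; last by rewrite dimL.
move=> Y /coordL[a [c [e [f [k []]]]]] ->.
move=> /contraNeq/(_ nf)-> /contraNeq/(_ ne)-> _ _.
by rewrite /X0 /ec /ek; span3_sp a c k.
Qed.

End Subalgebras.

(** * Normal forms of elements *)

Section SymplecticForm.
Variable F : numFieldType.
Implicit Types (u v w : 'rV[F]_4) (X g : 'M[F]_4) (p q : {poly F}).

(** The form lives on row vectors, on which matrices act from the right; a matrix is in [Sp4] when
    its rows have Gram matrix [J]. *)
Definition symp u v : F := (u *m J F *m v^T) 0 0.

Lemma sympDl u u' v : symp (u + u') v = symp u v + symp u' v.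
Proof. by rewrite /symp !mulmxDl mxE. Qed.

Lemma sympZl c u v : symp (c *: u) v = c * symp u v.
Proof. by rewrite /symp -!scalemxAl mxE. Qed.

Lemma sympNl u v : symp (- u) v = - symp u v.
Proof. by rewrite -scaleN1r sympZl mulN1r. Qed.

Lemma symp0l v : symp 0 v = 0.
Proof. by rewrite /symp !mul0mx mxE. Qed.

Lemma trmx_J : (J F)^T = - J F.
Proof. by rewrite J_mx4; mx4_compute; ring. Qed.

Lemma sympC u v : symp u v = - symp v u.
Proof.
have tr1 (M : 'M[F]_1) : M 0 0 = M^T 0 0 by rewrite mxE.
rewrite /symp tr1 !trmx_mul trmxK trmx_J mulmxA.
by rewrite mulmxN mulNmx mxE.
Qed.

Lemma sympuu u : symp u u = 0.
Proof. by apply/eqP; rewrite -eqNr -sympC. Qed.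

Lemma sympDr u v v' : symp u (v + v') = symp u v + symp u v'.
Proof. by rewrite sympC sympDl opprD -!sympC. Qed.

Lemma sympZr c u v : symp u (c *: v) = c * symp u v.
Proof. by rewrite sympC sympZl -mulrN -sympC. Qed.

Lemma sympNr u v : symp u (- v) = - symp u v.
Proof. by rewrite -scaleN1r sympZr mulN1r. Qed.

Lemma symp_nondegenerate u : u != 0 -> exists v, symp u v != 0.
Proof.
move=> nu; have: u *m J F != 0.
  apply: contra nu => /eqP uJ0.
  by rewrite -[u](mulmxK (J_unit F)) uJ0 mul0mx eqxx.
case/rV0Pn => j uj; exists (delta_mx 0 j).
by rewrite /symp trmx_delta -colE mxE.
Qed.

(** Since $J^2 = -1$, the equation $JX^tJ = X$ says that [X] is skew for the form. *)
Lemma symp_adjoint X u v :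
  X \in @sp4 F -> symp (u *m X) v = - symp u (v *m X).
Proof.
move=> /eqP XJ; rewrite /symp -{1}XJ !mulmxA mulJJ trmx_mul !mulNmx [LHS]mxE.
by rewrite !mulmxA.
Qed.

(** The adjoint of [X] is $-X$, so that of $p(X)$ is $p(-X)$. *)
Lemma symp_horner X p u v : X \in @sp4 F ->
  symp (u *m horner_mx X p) v = symp u (v *m horner_mx X (p \Po - 'X)).
Proof.
move=> Xsp; elim/poly_ind: p u v => [|p c IHp] u v.
  by rewrite comp_poly0 !rmorph0 !mulmx0 symp0l sympC symp0l oppr0.
rewrite comp_polyD comp_polyC comp_polyM comp_polyX [_ * - 'X]mulrC.
rewrite !(rmorphD, rmorphM, rmorphN) /= horner_mx_X horner_mx_C -!mulmxE.
rewrite !mulmxDr.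
rewrite !mul_mx_scalar sympDl sympDr sympZl sympZr; congr (_ + _).
by rewrite !mulmxA mulmxN mulNmx sympNr symp_adjoint // IHp.
Qed.

Lemma mulmx_horner_eigen X p u a :
  u *m X = a *: u -> u *m horner_mx X p = p.[a] *: u.
Proof.
move=> uX; elim/poly_ind: p => [|p c IHp].
  by rewrite rmorph0 mulmx0 horner0 scale0r.
rewrite rmorphD rmorphM /= horner_mx_X horner_mx_C -mulmxE.
rewrite mulmxDr mulmxA IHp.
by rewrite mul_mx_scalar -scalemxAl uX scalerA -scalerDl hornerMXaddC.
Qed.

Lemma mulmx_neq0 (M : 'M[F]_4) : M != 0 -> exists w : 'rV_4, w *m M != 0.
Proof.
by case/rowV0Pn=> _ /submxP[w ->]; exists w.
Qed.

(** $p(-X)$ is the adjoint of $p(X)$ and the form is nondegenerate. *)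
Lemma horner_sp4_comp_opp X p : X \in @sp4 F ->
  horner_mx X p = 0 -> horner_mx X (p \Po - 'X) = 0.
Proof.
move=> Xsp Xp0; apply/row_matrixP => i; rewrite row0 rowE; apply/eqP/negPn/negP.
case/symp_nondegenerate => w; rewrite sympC -symp_horner // Xp0 mulmx0 symp0l.
by rewrite oppr0 eqxx.
Qed.

(** The matrix [g] with rows [r] is symplectic by its Gram matrix, and the action of [X] on the rows
    reads $gX = sg$. *)
Lemma symplectic_frame X (s : seq (seq F)) (r : seq 'rV[F]_4) :
  (forall i j : 'I_4, symp r`_i r`_j = J F i j) ->
  (forall i : 'I_4, r`_i *m X = \sum_(j < 4) (nth [::] s i)`_j *: r`_j) ->
  exists2 g, g \in @Sp4 F & g *m X *m invmx g = mx4 s.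
Proof.
move=> gram rX; pose g : 'M[F]_4 := \matrix_(i < 4) r`_i.
have gSp : g \in @Sp4 F.
  apply/Sp4P/matrixP => i j; rewrite -gram /symp.
  have -> : r`_i = row i g by rewrite rowK.
  have -> : r`_j = row j g by rewrite rowK.
  by rewrite tr_row -row_mul colE mulmxA -row_mul -colE [RHS]mxE [RHS]mxE.
exists g => //; rewrite -[RHS](mulmxK (Sp4_unit gSp)); congr (_ *m _).
apply/row_matrixP => i; rewrite !row_mul rowK rX mulmx_sum_row.
by apply: eq_bigr => j _; rewrite rowK !mxE.
Qed.

End SymplecticForm.

(** * Symplectic bases adapted to an element *)

Section NormalForms.
Variable F : numClosedFieldType.
Implicit Types (u v w : 'rV[F]_4) (X : 'M[F]_4) (p q : {poly F}).

Lemma addmx_self_eq0 m n (M : 'M[F]_(m, n)) : M + M = 0 -> M = 0.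
Proof.
move/eqP; rewrite -mulr2n -scaler_nat scaler_eq0 pnatr_eq0 /=.
by move/eqP.
Qed.

Lemma mulmx_hornerM X p q u :
  u *m horner_mx X p *m horner_mx X q = u *m horner_mx X (p * q).
Proof. by rewrite rmorphM /= -mulmxE mulmxA. Qed.

Lemma mulmx_hornerX X p u : u *m horner_mx X p *m X = u *m horner_mx X (p * 'X).
Proof. by rewrite -mulmx_hornerM horner_mx_X. Qed.

Lemma mulmx_horner_eq0 X p q u :
  horner_mx X p = 0 -> p %| q -> u *m horner_mx X q = 0.
Proof.
by move=> Xp0 /dvdpP[r ->]; rewrite rmorphM /= Xp0 mulr0 mulmx0.
Qed.

Lemma symp_hornerr X p u v : X \in @sp4 F ->
  symp u (v *m horner_mx X p) = symp (u *m horner_mx X (p \Po - 'X)) v.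
Proof. by move=> Xsp; rewrite sympC symp_horner // -sympC. Qed.

(** Used to move a dual vector [v] into the generalized eigenspace for $-a$ while keeping its
    pairing with [u] nonzero, which needs only $p(-a) \neq 0$. *)
Lemma symp_horner_eigen X p a u v : X \in @sp4 F -> u *m X = a *: u ->
  symp u (v *m horner_mx X p) = p.[- a] * symp u v.
Proof.
move=> Xsp uX; rewrite symp_hornerr // (mulmx_horner_eigen _ uX) sympZl.
by rewrite horner_comp hornerN hornerX.
Qed.

(** Generalized eigenspaces for [a] and 0 are orthogonal when $a + 0 \neq 0$. *)
Lemma symp_eigen_nil X a v y : X \in @sp4 F -> a != 0 -> v *m X = a *: v ->
  y *m X *m X = 0 -> symp v y = 0 /\ symp v (y *m X) = 0.
Proof.
move=> Xsp na vX yXX.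
have e y' : a * symp v y' = - symp v (y' *m X).
  by rewrite -sympZl -vX symp_adjoint.
have vyX : symp v (y *m X) = 0.
  apply/eqP; rewrite -(mulrI_eq0 _ (mulfI na)) e yXX sympC symp0l oppr0.
  by rewrite oppr0.
split=> //; apply/eqP.
by rewrite -(mulrI_eq0 _ (mulfI na)) e vyX oppr0.
Qed.

(** The basis joins an eigenvector for 1 and a dual eigenvector for -1 with a pair [y], [y *m X] in
    the kernel of $X^2$. *)
Lemma T10_conj X : X \in @sp4 F ->
  horner_mx X (('X^2 - 1) * 'X^2) = 0 -> horner_mx X (('X^2 - 1) * 'X) != 0 ->
  horner_mx X 'X^2 != 0 ->
  exists2 g, g \in @Sp4 F & g *m X *m invmx g = sp_mx 1 0 0 0 0 0 1 0 0 0.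
Proof.
move=> Xsp X0 nX1 nX2.
pose h := horner_mx X; have h0 q u : ('X^2 - 1) * 'X^2 %| q -> u *m h q = 0.
  exact: mulmx_horner_eq0.
(* For $p = x^2(x + 1)$, the sum $p(x) + p(-x)$ is $2x^2$, so $p(X) = 0$ would force $X^2 = 0$. *)
have : h ('X^2 * ('X + 1)) != 0.
  apply: contra nX2 => /eqP e1; have e2 := horner_sp4_comp_opp Xsp e1.
  apply/eqP/addmx_self_eq0; rewrite -rmorphD -[RHS]addr0 -{1}e1 -e2 -rmorphD /=.
  congr (horner_mx X _).
  rewrite !(rmorphM, rmorphB, rmorphD, rmorph1, rmorphXn) /= !comp_polyX.
  by ring.
case/mulmx_neq0 => w; set v := w *m _ => nv.
have vX : v *m X = v.
  apply/eqP; rewrite -subr_eq0 mulmx_hornerX -mulmxBr -rmorphB h0 //.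
  by apply/dvdpP; exists 1; ring.
have [w' vw'] := symp_nondegenerate nv.
pose v' := w' *m h ('X^2 * ('X - 1)).
have v'X : v' *m X = - v'.
  apply/eqP; rewrite -addr_eq0 mulmx_hornerX -mulmxDr -rmorphD h0 //.
  by apply/dvdpP; exists 1; ring.
have vv' : symp v v' != 0.
  rewrite (@symp_horner_eigen X _ 1) ?scale1r // mulf_neq0 //.
  rewrite !hornerE /= sqrrN expr1n mul1r -opprD oppr_eq0.
  by rewrite (_ : 1 + 1 = 2%:R) // pnatr_eq0.
(* The bilinear form [symp y (z *m X)] is symmetric and does not vanish on the
   kernel of [X ^+ 2], so neither does its quadratic form. *)
have [y yXX qy] : exists2 y, y *m X *m X = 0 & symp y (y *m X) != 0.
  have [x] := mulmx_neq0 nX1; rewrite -mulmx_hornerX; set u := x *m _ => nuX.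
  have [z uXz] := symp_nondegenerate nuX; pose u' := z *m h ('X^2 - 1).
  have uXX : u *m X *m X = 0.
    by rewrite !mulmx_hornerX h0 //; apply/dvdpP; exists 1; ring.
  have u'XX : u' *m X *m X = 0.
    by rewrite !mulmx_hornerX h0 //; apply/dvdpP; exists 1; ring.
  have uXu' : symp (u *m X) u' != 0.
    rewrite (@symp_horner_eigen X _ 0) ?scale0r // mulf_neq0 //.
    by rewrite !hornerE /= oppr0 expr0n /= sub0r oppr_eq0 oner_eq0.
  have [qu|nqu] := eqVneq (symp u (u *m X)) 0; last by exists u.
  have [qu'|nqu'] := eqVneq (symp u' (u' *m X)) 0; last by exists u'.
  exists (u + u'); first by rewrite !mulmxDl uXX u'XX addr0.
  rewrite mulmxDl !sympDl !sympDr qu qu' add0r addr0.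
  rewrite -[symp u _]opprK -symp_adjoint // [symp u' _]sympC -opprD oppr_eq0.
  by rewrite -mulr2n -mulr_natr mulf_neq0 ?pnatr_eq0.
have [vy vyX] : symp v y = 0 /\ symp v (y *m X) = 0.
  by apply: (@symp_eigen_nil X 1); rewrite ?scale1r ?oner_eq0.
have [v'y v'yX] : symp v' y = 0 /\ symp v' (y *m X) = 0.
  by apply: (@symp_eigen_nil X (-1)); rewrite ?scaleN1r ?oppr_eq0 ?oner_eq0.
(* A square root normalizes the pairing of [y] with [y *m X] to 1, since scaling [y] by [c]
   multiplies it by $c^2$. *)
have [c cc] : exists c, c ^+ 2 * symp y (y *m X) = 1.
  by exists (sqrtC (symp y (y *m X))^-1); rewrite sqrtCK mulVf.
have antisym := (sympC y v, sympC y v', sympC (y *m X) v, sympC (y *m X) v',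
  sympC v' v, sympC (y *m X) y).
apply: (@symplectic_frame _ X _
  [:: (symp v v')^-1 *: v; c *: y; v'; c *: (y *m X)]) => [i j|i].
  move: i j; elim/ord4_ind; elim/ord4_ind; rewrite J_mx4 mxE /=;
    rewrite ?(sympZl, sympZr) ?antisym ?sympuu ?vy ?vyX ?v'y ?v'yX.
  all: rewrite ?mulrN ?mulVf // ?mulrA -?expr2 ?cc ?(mulr0, oppr0) //.
move: i; elim/ord4_ind; rewrite sum_ord4 /= !(scale0r, scale1r, add0r, addr0).
- by rewrite -scalemxAl vX.
- by rewrite -scalemxAl.
- by rewrite v'X scaleN1r.
- by rewrite -scalemxAl yXX scaler0 ?oppr0 ?scale0r ?addr0.
Qed.

(** A Jordan chain [r1], [r2] for the eigenvalue 1 is completed by a dual chain [r4], [r3] for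
    -1. *)
Lemma T11_conj X : X \in @sp4 F ->
  horner_mx X (('X^2 - 1) ^+ 2) = 0 -> horner_mx X ('X^2 - 1) != 0 ->
  exists2 g, g \in @Sp4 F & g *m X *m invmx g = sp_mx 1 1 0 1 0 0 0 0 0 0.
Proof.
move=> Xsp X0 nX.
pose h := horner_mx X; have h0 q u : ('X^2 - 1) ^+ 2 %| q -> u *m h q = 0.
  exact: mulmx_horner_eq0.
(* For this polynomial $p$, the sum $p(x) + p(-x)$ is $2(x^2 - 1)$. *)
have : h (('X + 1) ^+ 2 * ('X - 1)) != 0.
  apply: contra nX => /eqP e1; have e2 := horner_sp4_comp_opp Xsp e1.
  apply/eqP/addmx_self_eq0; rewrite -rmorphD -[RHS]addr0 -{1}e1 -e2 -rmorphD /=.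
  congr (horner_mx X _).
  rewrite !(rmorphM, rmorphB, rmorphD, rmorph1, rmorphXn) /= !comp_polyX.
  by ring.
case/mulmx_neq0 => w; set r2 := w *m _ => nr2.
pose u := w *m h (('X + 1) ^+ 2).
have uX : u *m X = u + r2.
  apply/eqP; rewrite -subr_eq0 mulmx_hornerX opprD addrA -!mulmxBr -!rmorphB /=.
  by rewrite h0 //; apply/dvdpP; exists 0; ring.
have r2X : r2 *m X = r2.
  apply/eqP; rewrite -subr_eq0 mulmx_hornerX -mulmxBr -rmorphB h0 //.
  by apply/dvdpP; exists 1; ring.
have [z r2z] := symp_nondegenerate nr2.
pose y := z *m h (('X - 1) ^+ 2).
have nr2y : symp r2 y != 0.
  rewrite (@symp_horner_eigen X _ 1) ?scale1r // mulf_neq0 //.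
  rewrite !hornerE /= -opprD sqrrN expf_neq0 //.
  by rewrite (_ : 1 + 1 = 2%:R) // pnatr_eq0.
(* The scaling makes [r4] dual to [r2]; [r3] is chosen so that the last row of the normal form holds
   by definition. *)
pose r4 := (symp r2 y)^-1 *: y; pose r3 := - (r4 *m X + r4).
have r3X : r3 *m X = - r3.
  apply/eqP; rewrite -addr_eq0 /r3 mulNmx -opprD oppr_eq0 /r4.
  rewrite -!(scalemxAl, scalerDr) scaler_eq0 mulmxDl; apply/orP; right.
  rewrite !mulmx_hornerX -!mulmxDr -!rmorphD h0 //.
  by apply/dvdpP; exists 1; ring.
have r4X : r4 *m X = - r3 - r4 by rewrite opprK addrK.
(* Subtracting a multiple of [r2] makes [r1] orthogonal to [r4] and keeps the chain relation. *)
pose r1 := u - symp u r4 *: r2.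
have r1X : r1 *m X = r1 + r2.
  by rewrite /r1 mulmxBl uX -scalemxAl r2X addrAC.
have s24 : symp r2 r4 = 1 by rewrite sympZr mulVf.
have s14 : symp r1 r4 = 0.
  by rewrite sympDl sympNl sympZl s24 mulr1 subrr.
have s12 : symp r1 r2 = 0.
  have := symp_adjoint r1 r2 Xsp; rewrite r1X r2X sympDl sympuu addr0 => e.
  by apply/eqP; rewrite -eqNr -e.
have s23 : symp r2 r3 = 0.
  rewrite sympNr sympDr -[symp r2 (_ *m X)]opprK -symp_adjoint // r2X.
  by rewrite addNr oppr0.
have s13 : symp r1 r3 = 1.
  rewrite sympNr sympDr -[symp r1 (_ *m X)]opprK -symp_adjoint // r1X.
  by rewrite sympDl s24 s14 add0r addr0 opprK.
clearbody r3.
have s34 : symp r3 r4 = 0.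
  have := symp_adjoint r3 r4 Xsp.
  rewrite r3X r4X sympNl sympDr !sympNr sympuu oppr0 add0r opprK => e.
  by apply/eqP; rewrite -eqNr e.
have antisym := (sympC r2 r1, sympC r3 r1, sympC r4 r1, sympC r3 r2,
  sympC r4 r2, sympC r4 r3).
apply: (@symplectic_frame _ X _ [:: r1; r2; r3; r4]) => [i j|i].
  move: i j; elim/ord4_ind; elim/ord4_ind; rewrite J_mx4 mxE /=;
    by rewrite ?sympuu ?antisym ?s12 ?s13 ?s14 ?s23 ?s24 ?s34 ?oppr0.
move: i; elim/ord4_ind; rewrite sum_ord4 /= ?oppr0;
  rewrite !(scale0r, scale1r, add0r, addr0) //.
- by rewrite r3X scaleN1r.
- by rewrite r4X !scaleN1r.
Qed.

End NormalForms.

(** * Reduction of an element to a normal form *)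

Section CayleyHamiltonNormalForm.
Variable F : numClosedFieldType.
Implicit Types (u v w : 'rV[F]_4) (X : 'M[F]_4) (p q : {poly F}).

Lemma diagonalizable_split X rs : uniq rs ->
  horner_mx X (\prod_(r <- rs) ('X - r%:P)) = 0 -> semisimple_mx X.
Proof. by move=> urs /mxminpoly_min dvd; apply/diagonalizableP; exists rs. Qed.

(** The roots are $\pm 1$ and $\pm\sqrt{e}$. They are distinct unless [e] is 0 or 1, and distinct
    roots would make [X] diagonalizable. *)
Lemma sp4_normal_form X e : X \in @sp4 F ->
  horner_mx X (('X^2 - 1) * ('X^2 - e%:P)) = 0 ->
  X ^+ 2 != 0 -> ~ semisimple_mx X ->
  exists2 g, g \in @Sp4 F &
    g *m X *m invmx g
      \in [:: sp_mx 1 1 0 1 0 0 0 0 0 0; sp_mx 1 0 0 0 0 0 1 0 0 0].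
Proof.
move=> Xsp X0 nX2 nss.
have one_neqN1 : (1 : F) != -1.
  by rewrite -addr_eq0 (_ : 1 + 1 = 2%:R) // pnatr_eq0.
have [e0|ne0] := eqVneq e 0.
  have [g gSp gX] : exists2 g, g \in @Sp4 F &
      g *m X *m invmx g = sp_mx 1 0 0 0 0 0 1 0 0 0.
    apply: T10_conj => //; first by move: X0; rewrite e0 subr0.
      apply/negP => /eqP h0; apply/nss/(@diagonalizable_split _ [:: 1; -1; 0]).
        by rewrite /= !inE negb_or one_neqN1 oppr_eq0 oner_eq0.
      rewrite !big_cons big_nil -[RHS]h0; congr horner_mx.
      by rewrite rmorphN /=; ring.
    by rewrite rmorphXn /= horner_mx_X.
  by exists g; rewrite // gX !inE eqxx orbT.
have [e1|ne1] := eqVneq e 1.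
  have [g gSp gX] : exists2 g, g \in @Sp4 F &
      g *m X *m invmx g = sp_mx 1 1 0 1 0 0 0 0 0 0.
    apply: T11_conj => //; first by move: X0; rewrite e1 expr2.
    apply/negP => /eqP h0; apply/nss/(@diagonalizable_split _ [:: 1; -1]).
      by rewrite /= !inE one_neqN1.
    rewrite !big_cons big_nil -[RHS]h0; congr horner_mx.
    by rewrite rmorphN /=; ring.
  by exists g; rewrite // gX !inE eqxx.
pose r := sqrtC e; have rr : r ^+ 2 = e by rewrite sqrtCK.
have sq x : x ^+ 2 = 1 -> (x == r) = false.
  by move=> x1; apply: contraNF ne1 => /eqP xr; rewrite -rr -xr x1.
case: nss; apply: (@diagonalizable_split _ [:: 1; -1; r; - r]).
  rewrite /= !inE !negb_or one_neqN1 eqr_opp -[1 == - r]eqr_oppLR.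
  rewrite !sq ?sqrrN ?expr1n //= -addr_eq0 -mulr2n -mulr_natr mulf_neq0 //.
    by rewrite -sqrf_eq0 rr.
  by rewrite pnatr_eq0.
rewrite !big_cons big_nil -[RHS]X0; congr horner_mx.
by rewrite -rr !rmorphN rmorphXn /=; ring.
Qed.

(** The characteristic polynomial $p(x)$ and $p(-x)$ both annihilate [X], hence so does the even
    part $x^4 + p_2x^2 + p_0$, which factors as a quadratic in $x^2$. *)
Lemma sp4_annihilator X : X \in @sp4 F -> exists s t,
  horner_mx X (('X^2 - s%:P) * ('X^2 - t%:P)) = 0.
Proof.
move=> Xsp; have h0 := Cayley_Hamilton X.
have h0' := horner_sp4_comp_opp Xsp h0.
pose p := char_poly X.
have [s [t [p2 p0]]] : exists s t, p`_2 = - (s + t) /\ p`_0 = s * t.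
  pose r := sqrtC (p`_2 ^+ 2 - 4 * p`_0).
  have rr : r ^+ 2 = p`_2 ^+ 2 - 4 * p`_0 by rewrite sqrtCK.
  by exists ((- p`_2 + r) / 2), ((- p`_2 - r) / 2); split; field: rr.
exists s, t; apply: addmx_self_eq0.
rewrite -[RHS]addr0 -{1}h0 -h0' -!rmorphD /=.
congr horner_mx.
have p4 : p`_4 = 1.
  by have /monicP := char_poly_monic X; rewrite lead_coefE size_char_poly.
have pE : p = 'X^4 + p`_3 *: 'X^3 + p`_2 *: 'X^2 + p`_1 *: 'X + (p`_0)%:P.
  rewrite -[LHS]coefK poly_def size_char_poly !big_ord_recr big_ord0 /=.
  by rewrite p4 -!mul_polyC; ring.
rewrite -/p pE -!mul_polyC !(rmorphD, rmorphM, rmorphXn) /=.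
by rewrite !comp_polyX !comp_polyC p2 p0 !(rmorphN, rmorphD, rmorphM) /=; ring.
Qed.

Lemma sp4_normal_form_scaled X : X \in @sp4 F -> ~ nilpotent_mx X ->
  (forall c, c != 0 -> ~ semisimple_mx (c *: X)) ->
  exists c, exists2 g, g \in @Sp4 F &
    g *m (c *: X) *m invmx g
      \in [:: sp_mx 1 1 0 1 0 0 0 0 0 0; sp_mx 1 0 0 0 0 0 1 0 0 0].
Proof.
move=> Xsp nnil nss.
have [s [t [ns X0]]] : exists s t,
    s != 0 /\ horner_mx X (('X^2 - s%:P) * ('X^2 - t%:P)) = 0.
  have [s [t X0]] := sp4_annihilator Xsp.
  have [s0|ns] := eqVneq s 0; last by exists s, t.
  have [t0|nt] := eqVneq t 0; last by exists t, s; rewrite mulrC.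
  case: nnil; exists 4%N; rewrite -[RHS]X0 s0 t0 subr0 -exprD.
  by rewrite rmorphXn /= horner_mx_X.
(* Scaling by $1/\sqrt{s}$ turns the squared eigenvalues [s], [t] into 1 and $t/s$. *)
pose c := (sqrtC s)^-1; have cc : c ^+ 2 = s^-1 by rewrite exprVn sqrtCK.
have nc : c != 0 by rewrite -sqrf_eq0 cc invr_eq0.
have Yss := nss c nc; set Y := c *: X in Yss.
have YY : Y * Y = s^-1 *: (X * X).
  by rewrite /Y -scalerAl -scalerAr scalerA -expr2 cc.
have Ysp : Y \in @sp4 F.
  move: Xsp; rewrite !inE /Y => /eqP XJ; apply/eqP.
  by rewrite linearZ /= -scalemxAr -scalemxAl XJ.
have [|||g gSp gY] := @sp4_normal_form Y (t / s) Ysp.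
- move: X0; rewrite !(rmorphM, rmorphB, rmorphXn, rmorph1) /=.
  rewrite !horner_mx_X !horner_mx_C.
  move=> X0; rewrite YY.
  have -> : s^-1 *: (X * X) - 1 = s^-1 *: (X * X - s%:M).
    by rewrite scalerBr scale_scalar_mx mulVf.
  have -> : s^-1 *: (X * X) - t%:M * (s^-1)%:M = s^-1 *: (X * X - t%:M).
    by rewrite scalerBr scale_scalar_mx [s^-1 * t]mulrC scalar_mxM mulmxE.
  by rewrite -scalerAl -scalerAr X0 !scaler0.
- rewrite expr2 YY scaler_eq0 invr_eq0 (negPf ns); apply/negP => /eqP XX.
  by case: nnil; exists 2%N; rewrite expr2.
- exact: Yss.
by exists c, g.
Qed.

End CayleyHamiltonNormalForm.

(** * Classification and inequivalence *)

Section Invariance.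
Variable F : fieldType.
Implicit Types (X Y g : 'M[F]_4) (A B L : {vspace 'M[F]_4}).

Lemma lie_bracket_conj g X Y : g \in unitmx ->
  lie_bracket (g *m X *m invmx g) (g *m Y *m invmx g) =
  g *m lie_bracket X Y *m invmx g.
Proof.
move=> ug; rewrite /lie_bracket mulmxBr mulmxBl.
by rewrite !mulmxA !(mulmxKV ug).
Qed.

Lemma sp4_subalgebra_equiv A B :
  sp4_equiv A B -> sp4_subalgebra A -> sp4_subalgebra B.
Proof.
case=> g gSp AB [Asp Abr]; have ug := Sp4_unit gSp; split.
  by move=> _ /AB[X XA ->]; rewrite sp4_conj ?Asp.
move=> _ _ /AB[X XA ->] /AB[Y YA ->]; rewrite lie_bracket_conj //.
by apply/AB; exists (lie_bracket X Y); rewrite ?Abr.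
Qed.

Lemma semisimple_conj_T g (a b : F) : g \in unitmx ->
  semisimple_mx (invmx g *m T a b *m g).
Proof.
move=> ug; exists g => //; apply/(diagonalizable_forLR ug).
exists (\row_(i < 4) [:: a; b; - a; - b]`_i).
by rewrite mxpoly.conjumx ?unitmx_inv // invmxK.
Qed.

(** A conjugacy invariant. Both eigenvalues belong to the same [X]; since [X] may be rescaled, it is
    their ratio that carries information. *)
Definition ad_weights L (r s : F) := exists X Y Z,
  [/\ X \in L, Y \in L & Z \in L] /\
  [/\ Y != 0, Z != 0, lie_bracket X Y = r *: Y & lie_bracket X Z = s *: Z].

Lemma ad_weights_equiv A B r s :
  sp4_equiv A B -> ad_weights A r s -> ad_weights B r s.
Proof.
case=> g gSp AB [X [Y [Z [[XA YA ZA] [nY nZ XY XZ]]]]].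
have ug := Sp4_unit gSp.
have cj W : W \in A -> g *m W *m invmx g \in B by move=> WA; apply/AB; exists W.
have nz W : W != 0 -> g *m W *m invmx g != 0.
  apply: contra => /eqP W0; rewrite -[W](mulKmx ug).
  by rewrite -[g *m W](mulmxKV ug) W0 mul0mx mulmx0.
exists (g *m X *m invmx g), (g *m Y *m invmx g), (g *m Z *m invmx g).
split; split; rewrite ?cj ?nz ?lie_bracket_conj //.
  by rewrite XY -scalemxAr -scalemxAl.
by rewrite XZ -scalemxAr -scalemxAl.
Qed.

End Invariance.

(** * Weights of the listed algebras and the classification *)

Section Weights.
Variable F : numClosedFieldType.

Lemma L1_subalgebra : sp4_subalgebra (@L1 F).
Proof.
rewrite L1E; split=> [_ /span3P[a [y [z ->]]]|].
  by rewrite !(sp_mxZ, sp_mxD) sp_mx_sp4.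
move=> _ _ /span3P[a [y [z ->]]] /span3P[a' [y' [z' ->]]].
rewrite !(sp_mxZ, sp_mxD, sp_bracket).
(* The first generator sends $X_{\alpha+\beta}$ to $2X_{\alpha+\beta} + 2X_{\alpha+2\beta}$ and
   $X_{\alpha+2\beta}$ to $2X_{\alpha+2\beta}$. *)
span3_sp (0 : F) (2 * (a * y' - a' * y))
  (2 * (a * (z' + y') - a' * (z + y))).
Qed.

Lemma L2_subalgebra : sp4_subalgebra (@L2 F).
Proof.
rewrite L2E; split=> [_ /span3P[a [y [z ->]]]|].
  by rewrite !(sp_mxZ, sp_mxD) sp_mx_sp4.
move=> _ _ /span3P[a [y [z ->]]] /span3P[a' [y' [z' ->]]].
rewrite !(sp_mxZ, sp_mxD, sp_bracket).
span3_sp (0 : F) (- 2 * (a * y' - a' * y)) (2 * (a * z' - a' * z)).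
Qed.

Lemma L3_subalgebra : sp4_subalgebra (@L3 F).
Proof.
rewrite L3E; split=> [_ /span3P[a [y [z ->]]]|].
  by rewrite !(sp_mxZ, sp_mxD) sp_mx_sp4.
move=> _ _ /span3P[a [y [z ->]]] /span3P[a' [y' [z' ->]]].
rewrite !(sp_mxZ, sp_mxD, sp_bracket).
span3_sp (0 : F) (a * y' - a' * y) (2 * (a * z' - a' * z)).
Qed.

Lemma L2_weights : ad_weights (@L2 F) 2 (-2).
Proof.
rewrite L2E; exists (sp_mx 1 0 0 (-1) 0 1 0 0 0 0),
  (sp_mx 0 0 0 0 1 0 0 0 0 0), (sp_mx 0 0 0 0 0 0 1 0 0 0).
split; split; rewrite ?memv_span ?inE ?eqxx ?orbT //.
- by apply/eqP; rewrite -sp_mx0 => /sp_mx_inj[_ [/eqP]]; rewrite oner_eq0.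
- by apply/eqP; rewrite -sp_mx0 => /sp_mx_inj[_ [_ _ /eqP]]; rewrite oner_eq0.
- by sp_compute; ring.
- by sp_compute; ring.
Qed.

Lemma L3_weights : ad_weights (@L3 F) 1 2.
Proof.
rewrite L3E; exists (sp_mx 1 0 0 0 0 0 1 0 0 0),
  (sp_mx 0 0 0 0 0 1 0 0 0 0), (sp_mx 0 0 0 0 1 0 0 0 0 0).
split; split; rewrite ?memv_span ?inE ?eqxx ?orbT //.
- by apply/eqP; rewrite -sp_mx0 => /sp_mx_inj[_ [_ /eqP]]; rewrite oner_eq0.
- by apply/eqP; rewrite -sp_mx0 => /sp_mx_inj[_ [/eqP]]; rewrite oner_eq0.
- by sp_compute; ring.
- by sp_compute; ring.
Qed.

(** Brackets in [L1] have no component along the first generator, so [Y] lies in the span of the two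
    root vectors, where ad [X] has the single eigenvalue $2t$. *)
Lemma L1_weight X Y t y z r : X = sp_mx t t 0 t z y 0 0 0 0 ->
  Y \in L1 -> Y != 0 -> r != 0 -> lie_bracket X Y = r *: Y -> r = 2 * t :> F.
Proof.
rewrite L1E => -> /span3P[a [f [e EY]]].
have {EY}-> : Y = sp_mx a a 0 a e f 0 0 0 0.
  by rewrite EY; sp_compute; ring.
move=> nY nr; rewrite (_ : lie_bracket _ _ = sp_mx 0 0 0 0
  (2 * (t * (e + f) - a * (z + y))) (2 * (t * f - a * y)) 0 0 0 0); last first.
  by sp_compute; ring.
rewrite sp_mxZ => /sp_mx_inj[[/esym/eqP a0 _ _ _] [eqe eqf _] _].
move: a0 nY eqe eqf; rewrite mulf_eq0 (negPf nr) => /eqP -> nY eqe eqf.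
have [f0|nf] := eqVneq f 0; last first.
  by apply: (mulIf nf); rewrite -eqf; ring.
have [e0|ne] := eqVneq e 0; last first.
  by apply: (mulIf ne); rewrite -eqe f0; ring.
by case/eqP: nY; rewrite e0 f0 sp_mx0.
Qed.

Lemma L1_weights_eq r s :
  r != 0 -> s != 0 -> ad_weights (@L1 F) r s -> r = s.
Proof.
move=> nr ns [X [Y [Z [[XL YL ZL] [nY nZ XY XZ]]]]].
move: XL; rewrite L1E => /span3P[t [y [z EX]]].
have {}EX : X = sp_mx t t 0 t z y 0 0 0 0 by rewrite EX; sp_compute; ring.
by rewrite (L1_weight EX YL nY nr XY) (L1_weight EX ZL nZ ns XZ).
Qed.

(** As for [L1], but here ad [X] has the eigenvalue $t$ on $X_{\alpha+\beta}$ and $2t$ on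
    $X_{\alpha+2\beta}$. *)
Lemma L3_weight X Y t y z r : X = sp_mx t 0 0 0 z y t 0 0 0 ->
  Y \in L3 -> Y != 0 -> r != 0 -> lie_bracket X Y = r *: Y ->
  r = t \/ r = 2 * t :> F.
Proof.
rewrite L3E => -> /span3P[a [f [e EY]]].
have {EY}-> : Y = sp_mx a 0 0 0 e f a 0 0 0.
  by rewrite EY; sp_compute; ring.
move=> nY nr; rewrite (_ : lie_bracket _ _ = sp_mx 0 0 0 0
  (2 * (t * e - a * z)) (t * f - a * y) 0 0 0 0); last first.
  by sp_compute; ring.
rewrite sp_mxZ => /sp_mx_inj[[/esym/eqP a0 _ _ _] [eqe eqf _] _].
move: a0 nY eqe eqf; rewrite mulf_eq0 (negPf nr) => /eqP -> nY eqe eqf.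
have [f0|nf] := eqVneq f 0; last first.
  by left; apply: (mulIf nf); rewrite -eqf; ring.
have [e0|ne] := eqVneq e 0; last first.
  by right; apply: (mulIf ne); rewrite -eqe; ring.
by case/eqP: nY; rewrite e0 f0 sp_mx0.
Qed.

Lemma L3_not_weights : ~ ad_weights (@L3 F) 2 (-2).
Proof.
move=> [X [Y [Z [[XL YL ZL] [nY nZ XY XZ]]]]].
move: XL; rewrite L3E => /span3P[t [y [z EX]]].
have {}EX : X = sp_mx t 0 0 0 z y t 0 0 0 by rewrite EX; sp_compute; ring.
have n2 : (2 : F) != 0 by rewrite pnatr_eq0.
have nN2 : (-2 : F) != 0 by rewrite oppr_eq0.
(* The weight 2 forces [t] to be 1 or 2, and the weight -2 forces it to be -1 or -2. *)
have t12 : 1 <= t.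
  have [<-|/esym t2] := L3_weight EX YL nY n2 XY; first by rewrite ler1n.
  by rewrite (_ : t = 1) //; apply: (mulfI n2); rewrite mulr1.
have tN12 : t <= -1.
  have [<-|/esym t2] := L3_weight EX ZL nZ nN2 XZ.
    by rewrite lerN2 ler1n.
  by rewrite (_ : t = -1) //; apply: (mulfI n2); rewrite mulrN1.
have := le_trans t12 tN12; rewrite -subr_ge0 -opprD oppr_ge0.
by rewrite (_ : 1 + 1 = 2%:R) // lern0.
Qed.

Lemma L1_L2_inequiv : ~ @sp4_equiv F L1 L2.
Proof.
move=> /sp4_equiv_sym/ad_weights_equiv/(_ L2_weights)/L1_weights_eq eq2.
have n2 : (2 : F) != 0 by rewrite pnatr_eq0.
move: n2; rewrite -[2]/(2%:R) -eqNr => /eqP; apply.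
by rewrite -eq2 // ?oppr_eq0 pnatr_eq0.
Qed.

Lemma L1_L3_inequiv : ~ @sp4_equiv F L1 L3.
Proof.
move=> /sp4_equiv_sym/ad_weights_equiv/(_ L3_weights)/L1_weights_eq eq12.
have /eqP := eq12 (oner_neq0 _) (negbT (pnatr_eq0 _ 2)).
by rewrite (eqr_nat F 1 2).
Qed.

Lemma L2_L3_inequiv : ~ @sp4_equiv F L2 L3.
Proof. by move=> /ad_weights_equiv/(_ L2_weights)/L3_not_weights. Qed.

Lemma sp4_classification (L : {vspace 'M[F]_4}) :
  sp4_subalgebra L -> \dim L = 3%N ->
  (forall X, X \in L -> semisimple_mx X -> X = 0) ->
  ~ (forall X, X \in L -> nilpotent_mx X) ->
  [\/ sp4_equiv L L1, sp4_equiv L L2 | sp4_equiv L L3].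
Proof.
move=> Lsub dimL ss0 notnil.
have [X XL nX] : exists2 X, X \in L & ~ nilpotent_mx X.
  apply: contrapT => noX; apply: notnil => X XL.
  by apply: contrapT => nX; apply: noX; exists X.
have nss c : c != 0 -> ~ semisimple_mx (c *: X).
  move=> nc /(ss0 _ (memvZ _ XL))/eqP; rewrite scaler_eq0 (negPf nc) => /eqP X0.
  by apply: nX; exists 1%N; rewrite X0 expr1.
have [c [g gSp gX]] := sp4_normal_form_scaled (proj1 Lsub X XL) nX nss.
have ug := Sp4_unit gSp; have LL' := sp4_equiv_conjv L gSp.
have L'sub := sp4_subalgebra_equiv LL' Lsub.
have dimL' : \dim (conjv g L) = 3%N by rewrite dim_conjv.
(* Such an element is $T_{a,b}$, and conjugating it back would give a nonzero semisimple element of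
   [L]. Both $T_{1,1}$ and $T_{1,0}$ are covered. *)
have nT a b : a != 0 -> sp_mx a 0 0 b 0 0 0 0 0 0 \notin conjv g L.
  move=> na; apply/negP => /conjvP[Z ZL]; rewrite -T_sp => TZ.
  have EZ : Z = invmx g *m T a b *m g.
    by rewrite TZ !mulmxA mulVmx // mul1mx mulmxKV.
  have Z0 : Z = 0 by apply: ss0; rewrite // EZ; apply: semisimple_conj_T.
  move: TZ; rewrite Z0 mulmx0 mul0mx T_sp -sp_mx0 => /sp_mx_inj[[/eqP]].
  by rewrite (negPf na).
have := mem_conjv g (memvZ c XL); move: gX; rewrite !inE => /orP[]/eqP-> X0L.
  have [L1L|L2L] := T11_subalgebra L'sub dimL' (nT _ _ (oner_neq0 F)) X0L.
    by apply: Or31; apply: sp4_equiv_trans LL' L1L.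
  by apply: Or32; apply: sp4_equiv_trans LL' L2L.
apply: Or33; apply: sp4_equiv_trans LL' _.
exact: T10_subalgebra L'sub dimL' (nT _ _ (oner_neq0 F)) X0L.
Qed.

End Weights.

(** * The theorem over the complex numbers [R[i]] *)

Theorem theorem7p8 (R : realType) :
  (* classification *)
  (forall L : {vspace 'M[R[i]]_4},
     sp4_subalgebra L ->
     \dim L = 3%N ->
     lie_solvable L ->
     (forall X : 'M[R[i]]_4, X \in L -> semisimple_mx X -> X = 0) ->
     ~ (forall X : 'M[R[i]]_4, X \in L -> nilpotent_mx X) ->
     [\/ sp4_equiv L L1, sp4_equiv L L2 | sp4_equiv L L3]) /\
  (* the listed spaces are subalgebras *)
  (forall A : {vspace 'M[R[i]]_4},
     A \in [:: L1; L1'; L2; L3; L3'] -> sp4_subalgebra A) /\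
  (* algebras on the same line are equivalent *)
  (@sp4_equiv R[i] L1 L1' /\ @sp4_equiv R[i] L3 L3') /\
  (* algebras on different lines are inequivalent *)
  (forall A B : {vspace 'M[R[i]]_4},
     [\/ A \in [:: L1; L1'] /\ B \in [:: L2],
         A \in [:: L1; L1'] /\ B \in [:: L3; L3']
       | A \in [:: L2] /\ B \in [:: L3; L3'] ] ->
     ~ sp4_equiv A B).
Proof.
have LL1 := L1_equiv_L1' R[i]; have LL3 := L3_equiv_L3' R[i].
split; first by move=> L Lsub dimL _; apply: sp4_classification.
split.
  move=> A; rewrite !inE => /or4P[|||/orP[]]/eqP->.
  - exact: L1_subalgebra.
  - exact: sp4_subalgebra_equiv LL1 (L1_subalgebra _).
  - exact: L2_subalgebra.
  - exact: L3_subalgebra.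
  - exact: sp4_subalgebra_equiv LL3 (L3_subalgebra _).
split=> // A B hAB AB.
(* Transitivity reduces inequivalence between lines to the representatives [L1], [L2] and [L3]. *)
have line1 : A \in [:: L1; L1'] -> sp4_equiv L1 A.
  by rewrite !inE => /orP[]/eqP-> //; apply: sp4_equiv_refl.
have line3 : B \in [:: L3; L3'] -> sp4_equiv B L3.
  rewrite !inE => /orP[]/eqP->; first exact: sp4_equiv_refl.
  exact: sp4_equiv_sym.
case: hAB => -[].
- move=> /line1 L1A; rewrite inE => /eqP B2; apply: (@L1_L2_inequiv R[i]).
  by rewrite -B2; apply: sp4_equiv_trans L1A AB.
- move=> /line1 L1A /line3 BL3; apply: (@L1_L3_inequiv R[i]).
  exact: sp4_equiv_trans L1A (sp4_equiv_trans AB BL3).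
- rewrite inE => /eqP A2 /line3 BL3; apply: (@L2_L3_inequiv R[i]).
  by rewrite -A2; apply: sp4_equiv_trans AB BL3.
Qed.
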